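(* For each prime $p\ge3$, there are at least two non-torsion multi-EGS groups $G$ and $H$ (acting on the $p$-adic tree), with non-isomorphic profinite completions, each of finite central width.
   Context: **Central width.** For a pro-$p$ group $\Gamma$, the central width is $w_{\mathrm{cen}}(\Gamma)=\sup\{\log_p|\Delta:[\Delta,\Gamma]|\mid \Delta\trianglelefteq\Gamma \text{ open normal}\}\in\mathbb{N}_0\cup\{\infty\}$, where $[\Delta,\Gamma]$ is understood as the closed subgroup generated by the commutators. ''Each of finite central width'' refers to the two profinite completions (which are pro-$p$ groups). **Tree and automorphisms.** The $p$-adic tree $T$ is the infinite rooted tree whose vertices are the finite words over $X=\{1,\dots,p\}$ (root: the empty word), with an edge between $u$ and $ux$ for every word $u$ and $x\in X$. $\operatorname{Aut} T$ acts on the right, $u\mapsto u^f$. For $f\in\operatorname{Aut}T$ and a vertex $u$, the section $f_u\in \operatorname{Aut}T$ is given by $(uv)^f=u^fv^{f_u}$ for all words $v$. $\operatorname{St}_{\operatorname{Aut}T}(1)$ is the pointwise stabiliser of the vertices $1,\dots,p$, and $\psi\colon\operatorname{St}_{\operatorname{Aut}T}(1)\to \operatorname{Aut}T\times\overset{p}{\cdots}\times\operatorname{Aut}T$, $g\mapsto(g_1,\dots,g_p)$. **Multi-EGS groups.** Let $a\in\operatorname{Aut}T$ be the rooted automorphism $(xv)^a=x^{\sigma}v$, where $\sigma=(1\,2\,\cdots\,p)$. Let $r_1,\dots,r_p\in\{0,1,\dots,p-1\}$, not all zero, and for each $j\in\{1,\dots,p\}$ let $\mathbf{e}^{(j)}_1,\dots,\mathbf{e}^{(j)}_{r_j}$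 be $\mathbb{F}_p$-linearly independent vectors, $\mathbf{e}^{(j)}_i=(e^{(j)}_{i,1},\dots,e^{(j)}_{i,p-1})\in\mathbb{F}_p^{\,p-1}$. Define directed automorphisms $b^{(j)}_i\in\operatorname{St}_{\operatorname{Aut}T}(1)$ recursively by $$\psi(b^{(j)}_i)=\bigl(a^{e^{(j)}_{i,j}},\dots,a^{e^{(j)}_{i,p-1}},\,b^{(j)}_i,\,a^{e^{(j)}_{i,1}},\dots,a^{e^{(j)}_{i,j-1}}\bigr).$$ The associated multi-EGS group is $\langle\{a\}\cup\{b^{(j)}_i\mid 1\le j\le p,\ 1\le i\le r_j\}\rangle$. Non-torsion means that the group is not a torsion group. *)

(* Defs.v *)
From HB Require Import structures.
From mathcomp Require Import all_boot all_order all_algebra.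
From mathcomp Require Import all_classical all_reals all_analysis.

Set Implicit Arguments.
Unset Strict Implicit.
Unset Printing Implicit Defensive.

Local Open Scope classical_set_scope.
Local Open Scope group_scope.

Section Subgroups.
Variable U : groupType.
Implicit Types (A N : set U).

Definition is_subgroup : set (set U) := [set A | group_closed [in A]].

Record subgroup := Subgroup {
  subgroup_set :> set U;
  subgroup_closed : is_subgroup subgroup_set }.

Definition subgroup_type (G : subgroup) : Type :=
  {x : U | x \in subgroup_set G}.

HB.instance Definition _ (G : subgroup) := SubChoice.on (subgroup_type G).
HB.instance Definition _ (G : subgroup) :=
  SubChoice_isSubGroup.Build U [in subgroup_set G] (subgroup_type G)
    (subgroup_closed G).

Definition generated A : set U := smallest is_subgroup A.

Definition normalised A : Prop := forall x y, A x -> A (x ^ y).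

Definition lcoset N (x : U) : set U := [set x * n | n in N].

Definition lcosets A N : set (set U) := [set lcoset N x | x in A].

Definition torsion : Prop := forall x : U, exists2 n, (0 < n)%N & x ^+ n = 1.

Lemma is_subgroupP A : is_subgroup A <->
  [/\ A 1, forall x y, A x -> A y -> A (x * y) & forall x, A x -> A x^-1].
Proof.
split=> [[/set_mem A1 AD]|[A1 AM AV]]; last first.
  split; first exact/mem_set.
  by move=> x y /set_mem Ax /set_mem Ay; apply/mem_set/AM => //; exact: AV.
have {}AD x y : A x -> A y -> A (x / y).
  by move=> /mem_set Ax /mem_set Ay; apply/set_mem/AD.
have AV x : A x -> A x^-1 by move=> Ax; rewrite -[x^-1]mul1g; exact: AD.
by split=> // x y Ax Ay; rewrite -[y]invgK; exact/AD/AV.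
Qed.

Lemma smallest_subgroup (P : set (set U)) A : P `<=` is_subgroup ->
  is_subgroup (smallest P A).
Proof.
move=> PS; apply/is_subgroupP; split=> [B /= BP|x y Gx Gy B /= BP|x Gx B /= BP];
  have [/PS/is_subgroupP[B1 BM BV] _] := BP => //.
- by apply: BM; [exact: Gx | exact: Gy].
- by apply: BV; exact: Gx.
Qed.

Lemma generated_subgroup A : is_subgroup (generated A).
Proof. exact: smallest_subgroup. Qed.

End Subgroups.

Definition generated_group (U : groupType) (A : set U) : subgroup U :=
  Subgroup (generated_subgroup A).

HB.mixin Record isTopologicalGroup G of Group G & Topological G := {
  mulg_continuous : continuous (fun xy : G * G => xy.1 * xy.2);
  invg_continuous : continuous (fun x : G => x^-1) }.

#[short(type="topologicalGroupType")]
HB.structure Definition TopologicalGroup :=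
  {G of Group G & Topological G & isTopologicalGroup G}.

Definition topologically_isomorphic (G H : topologicalGroupType) : Prop :=
  exists (f : {multiplicative G -> H}) (g : H -> G),
    [/\ cancel f g, cancel g f, continuous f & continuous g].

Section CentralWidth.
Variable G : topologicalGroupType.

Definition open_normal_subgroup : set (set G) :=
  [set D | [/\ is_subgroup D, normalised D & open D]].

Definition pro_p (p : nat) : Prop :=
  [/\ compact [set: G], hausdorff_space G, totally_disconnected [set: G] &
      forall D, open_normal_subgroup D ->
        exists n, (lcosets setT D #= `I_(p ^ n))%card].

Definition closed_commutator (A B : set G) : set G :=
  smallest [set K | is_subgroup K /\ closed K]
           [set [~ x, y] | x in A & y in B].

Definition subgroup_index (R : realType) (A B : set G) : \bar R :=
  counting (lcosets A B).

Definition central_width (R : realType) (p : nat) : \bar R :=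
  ereal_sup [set (lne (subgroup_index R D (closed_commutator D setT)) *
                  ((ln p%:R)^-1)%:E)%E | D in open_normal_subgroup].

(* The central width is only considered for pro-p groups. *)
Definition finite_central_width (R : realType) (p : nat) : Prop :=
  pro_p p /\ (central_width R p < +oo)%E.

End CentralWidth.

Record finite_index_normal (G : groupType) := FiniteIndexNormal {
  fin_set :> set G;
  fin_subgroup : is_subgroup fin_set;
  fin_normal : normalised fin_set;
  fin_index : finite_set (lcosets setT fin_set) }.

(* An element of the inverse limit of the quotients [G / N], presented as a
   family of cosets; the bonding map [G / M -> G / N] sends a coset of [M] to
   the coset of [N] that contains it. *)
Record profinite_completion (G : groupType) := ProfiniteCompletion {
  pc_fun :> finite_index_normal G -> set G;
  pc_coset : forall N : finite_index_normal G, lcosets setT N (pc_fun N);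
  pc_compat : forall M N : finite_index_normal G,
    M `<=` N -> pc_fun M `<=` pc_fun N }.

Section ProfiniteCompletion.
Variable G : groupType.
Implicit Types (N M : finite_index_normal G) (x y z : profinite_completion G).
Local Notation pc := (profinite_completion G).

HB.instance Definition _ := gen_eqMixin pc.
HB.instance Definition _ := gen_choiceMixin pc.

Lemma pcP x y : (forall N, x N = y N) -> x = y.
Proof.
case: x y => [f fN fM] [g gN gM] /= fg.
have {}fg : f = g by apply/funext.
by subst g; congr ProfiniteCompletion; exact: Prop_irrelevance.
Qed.

Lemma pcE x N : exists g, x N = lcoset N g.
Proof. by have [g _ <-] := pc_coset x N; exists g. Qed.

Lemma lcosetM N (g h : G) :
  [set a * b | a in lcoset N g & b in lcoset N h] = lcoset N (g * h).
Proof.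
have /is_subgroupP[N1 NM _] := fin_subgroup N.
apply/seteqP; split=> [_ [_ [m Nm <-]] [_ [n Nn <-]] <-|_ [n Nn <-]].
  exists (m ^ h * n); first by apply: NM => //; apply: fin_normal.
  by rewrite /conjg !mulgA mulgK.
exists g; first by exists 1; rewrite ?mulg1.
by exists (h * n); [exists n|rewrite mulgA].
Qed.

Lemma lcosetV N (g : G) : [set a^-1 | a in lcoset N g] = lcoset N g^-1.
Proof.
have /is_subgroupP[N1 NM NV] := fin_subgroup N.
apply/seteqP; split=> [_ [_ [n Nn <-] <-]|_ [n Nn <-]].
  exists (n^-1 ^ g^-1); first by apply: fin_normal; apply: NV.
  by rewrite /conjg invgK invgM !mulgA mulVg mul1g.
exists (g * (n^-1 ^ g)).
  by exists (n^-1 ^ g) => //; apply: fin_normal; apply: NV.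
by rewrite /conjg !mulgA mulgV mul1g invgM invgK.
Qed.

Program Definition pc_mul x y : pc :=
  ProfiniteCompletion
    (pc_fun := fun N => [set a * b | a in x N & b in y N]) _ _.
Next Obligation.
move=> x y N; have [g ->] := pcE x N; have [h ->] := pcE y N.
by rewrite lcosetM; exists (g * h).
Qed.
Next Obligation.
move=> x y M N MN _ [a xa] [b yb] <-.
by exists a; [exact: pc_compat xa|exists b => //; exact: pc_compat yb].
Qed.

Program Definition pc_one : pc :=
  ProfiniteCompletion (pc_fun := fun N => N : set G) _ _.
Next Obligation.
move=> N; exists 1 => //; apply/seteqP.
by split=> [_ [n Nn <-]|n Nn]; [rewrite mul1g|exists n; rewrite ?mul1g].
Qed.
Next Obligation. by []. Qed.

Program Definition pc_inv x : pc :=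
  ProfiniteCompletion (pc_fun := fun N => [set a^-1 | a in x N]) _ _.
Next Obligation.
by move=> x N; have [g ->] := pcE x N; rewrite lcosetV; exists g^-1.
Qed.
Next Obligation.
by move=> x M N MN _ [a xa] <-; exists a => //; exact: pc_compat xa.
Qed.

Lemma lcoset1 N : (N : set G) = lcoset N 1.
Proof.
apply/seteqP.
by split=> [n Nn|_ [n Nn <-]]; [exists n; rewrite ?mul1g|rewrite mul1g].
Qed.

Lemma pc_mulA : associative pc_mul.
Proof.
move=> x y z; apply: pcP => N /=.
have [[a ->] [b ->] [c ->]] := And3 (pcE x N) (pcE y N) (pcE z N).
by rewrite !lcosetM mulgA.
Qed.

Lemma pc_mul1 : left_id pc_one pc_mul.
Proof.
move=> x; apply: pcP => N /=; have [a ->] := pcE x N.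
by have := lcosetM N 1 a; rewrite -lcoset1 mul1g.
Qed.

Lemma pc_mul1r : right_id pc_one pc_mul.
Proof.
move=> x; apply: pcP => N /=; have [a ->] := pcE x N.
by have := lcosetM N a 1; rewrite -lcoset1 mulg1.
Qed.

Lemma pc_mulV : left_inverse pc_one pc_inv pc_mul.
Proof.
move=> x; apply: pcP => N /=; have [a ->] := pcE x N.
by rewrite lcosetV lcosetM mulVg -lcoset1.
Qed.

Lemma pc_mulVr : right_inverse pc_one pc_inv pc_mul.
Proof.
move=> x; apply: pcP => N /=; have [a ->] := pcE x N.
by rewrite lcosetV lcosetM mulgV -lcoset1.
Qed.

HB.instance Definition _ :=
  isGroup.Build pc pc_mulA pc_mul1 pc_mul1r pc_mulV pc_mulVr.

(* Each [G / N] is a subset of [set G], so the topology induced by the product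
   of the discrete spaces [G / N] is the one induced by this product. *)
Definition pc_embedding :
    pc -> prod_topology
            (fun _ : finite_index_normal G => discrete_topology (set G)) :=
  @pc_fun G.

HB.instance Definition _ := Topological.copy pc (initial_topology pc_embedding).

Lemma pc_nbhs x N : nbhs x [set y : pc | y N = x N].
Proof.
have emb_cont : continuous (pc_embedding : pc -> _).
  exact: initial_continuous.
have /cvg_sup/(_ N) emb_cvg : pc_embedding @ x --> pc_embedding x.
  exact: emb_cont.
suff : nbhs (pc_embedding x : initial_topology (fun f => f N))
    [set f | f N = x N].
  have FF : Filter (nbhs x) := nbhs_filter x.
  by move=> /emb_cvg; apply; exact: (fmap_filter pc_embedding FF).
exists (@^~ N @^-1` [set x N]); split=> //.
by exists [set x N] => //; exact: discrete_open.
Qed.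

Lemma pc_cvg (F : set_system pc) x : Filter F ->
  (forall N, F [set y : pc | y N = x N]) -> F --> x.
Proof.
move=> FF Fx A [_ [[B Bop <-] Bx BA]]; apply: (filterS BA).
have FF' : Filter (pc_embedding @ F) := fmap_filter pc_embedding FF.
suff /(_ B) : pc_embedding @ F --> pc_embedding x.
  by apply; apply: open_nbhs_nbhs.
apply/cvg_sup => N C [_ [[D Dop <-] /= Dx DC]].
suff: F (pc_embedding @^-1` C) by [].
apply: filterS (Fx N) => y yx; apply: DC.
by rewrite /= /pc_embedding (yx : y N = x N).
Qed.

Lemma pc_mul_continuous : continuous (fun xy : pc * pc => xy.1 * xy.2).
Proof.
move=> [x y] /=; apply: pc_cvg => N.
exists ([set u : pc | u N = x N], [set v : pc | v N = y N]).
  by split; exact: pc_nbhs.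
by move=> [u v] [/= -> ->].
Qed.

Lemma pc_inv_continuous : continuous (fun x : pc => x^-1).
Proof.
have FF x : Filter (nbhs (x : pc)) := nbhs_filter x.
move=> x; apply: (pc_cvg (fmap_filter _ (FF x))) => N.
apply: filterS (pc_nbhs x N) => y yx.
by rewrite /= (yx : y N = x N).
Qed.

HB.instance Definition _ :=
  isTopologicalGroup.Build pc pc_mul_continuous pc_inv_continuous.

End ProfiniteCompletion.

Section Tree.
Variable p : nat.
Local Notation word := (seq 'I_p).

Definition tree_edge (u v : word) : Prop :=
  exists x, v = rcons u x \/ u = rcons v x.

Record tree_aut := TreeAut {
  tree_fun :> word -> word;
  tree_inv : word -> word;
  tree_funK : cancel tree_fun tree_inv;
  tree_invK : cancel tree_inv tree_fun;
  tree_root : tree_fun [::] = [::];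
  tree_edgeE : forall u v,
    tree_edge (tree_fun u) (tree_fun v) <-> tree_edge u v }.

HB.instance Definition _ := gen_eqMixin tree_aut.
HB.instance Definition _ := gen_choiceMixin tree_aut.

Lemma tree_autP (f g : tree_aut) : f =1 g -> f = g.
Proof.
case: f g => [f f' fK f'K f0 fe] [g g' gK g'K g0 ge] /= fg.
have {}fg : f = g by apply/funext.
subst g; have fg' : f' = g' by apply/funext => u; rewrite -{1}[u]g'K fK.
by subst g'; congr TreeAut; exact: Prop_irrelevance.
Qed.

Program Definition tree_one : tree_aut := @TreeAut id id _ _ _ _.
Solve All Obligations with by [].

(* Automorphisms act on the right, so [f * g] applies [f] first. *)
Program Definition tree_mul (f g : tree_aut) : tree_aut :=
  @TreeAut (g \o f) (tree_inv f \o tree_inv g) _ _ _ _.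
Next Obligation. by move=> f g; apply: can_comp; exact: tree_funK. Qed.
Next Obligation. by move=> f g; apply: can_comp; exact: tree_invK. Qed.
Next Obligation. by move=> f g /=; rewrite !tree_root. Qed.
Next Obligation. by move=> f g u v /=; rewrite !tree_edgeE. Qed.

Program Definition tree_inverse (f : tree_aut) : tree_aut :=
  @TreeAut (tree_inv f) f _ _ _ _.
Next Obligation. by move=> f; exact: tree_invK. Qed.
Next Obligation. by move=> f; exact: tree_funK. Qed.
Next Obligation. by move=> f; rewrite -{1}(tree_root f) tree_funK. Qed.
Next Obligation. by move=> f u v; rewrite -(tree_edgeE f) !tree_invK. Qed.

Lemma tree_mulA : associative tree_mul.
Proof. by move=> f g h; exact: tree_autP. Qed.

Lemma tree_mul1 : left_id tree_one tree_mul.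
Proof. by move=> f; exact: tree_autP. Qed.

Lemma tree_mul1r : right_id tree_one tree_mul.
Proof. by move=> f; exact: tree_autP. Qed.

Lemma tree_mulV : left_inverse tree_one tree_inverse tree_mul.
Proof. by move=> f; apply: tree_autP => u /=; rewrite tree_invK. Qed.

Lemma tree_mulVr : right_inverse tree_one tree_inverse tree_mul.
Proof. by move=> f; apply: tree_autP => u /=; rewrite tree_funK. Qed.

HB.instance Definition _ := isGroup.Build tree_aut
  tree_mulA tree_mul1 tree_mul1r tree_mulV tree_mulVr.

Lemma tree_aut_rcons (f : tree_aut) u x :
  exists y, f (rcons u x) = rcons (f u) y.
Proof.
elim/last_ind: u x => [|u z IHu] x.
  have /(tree_edgeE f) [y [fE|fE]] : tree_edge [::] [:: x] by exists x; left.
    by exists y.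
  by move: fE; rewrite tree_root; case: (f [:: x]).
have /(tree_edgeE f) [y [fE|fE]] : tree_edge (rcons u z) (rcons (rcons u z) x).
- by exists x; left.
- by exists y.
have [z' uE] := IHu z; move: fE; rewrite uE => /rcons_inj[/esym fE _].
have /(congr1 size) : rcons (rcons u z) x = u.
  exact: can_inj (tree_funK f) _ _ fE.
by rewrite !size_rcons => /eqP; rewrite -addn2 -{2}[size u]addn0 eqn_add2l.
Qed.

Lemma tree_edge_homo (f : word -> word) :
    (forall u x, exists y, f (rcons u x) = rcons (f u) y) ->
  forall u v, tree_edge u v -> tree_edge (f u) (f v).
Proof.
move=> fr u v [x [->|->]]; first by have [y ->] := fr u x; exists y; left.
by have [y ->] := fr v x; exists y; right.
Qed.

Section Build.
Variables f g : word -> word.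
Hypotheses (fK : cancel f g) (gK : cancel g f) (f0 : f [::] = [::]).
Hypothesis f_rcons : forall u x, exists y, f (rcons u x) = rcons (f u) y.
Hypothesis g_rcons : forall u x, exists y, g (rcons u x) = rcons (g u) y.

Lemma build_edge u v : tree_edge (f u) (f v) <-> tree_edge u v.
Proof.
split; last exact: tree_edge_homo.
by move/(tree_edge_homo g_rcons); rewrite !fK.
Qed.

Definition build_tree_aut : tree_aut := TreeAut fK gK f0 build_edge.
End Build.

Definition map_head (s : 'I_p -> 'I_p) (w : word) : word :=
  if w is x :: v then s x :: v else [::].

Lemma map_headK s t : cancel s t -> cancel (map_head s) (map_head t).
Proof. by move=> sK [|x v] //=; rewrite sK. Qed.

Lemma map_head_rcons s u x :
  exists y, map_head s (rcons u x) = rcons (map_head s u) y.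
Proof. by case: u => [|z u]; [exists (s x)|exists x]. Qed.

(* [ordS] is the cycle (1 2 ... p) on ['I_p]. *)
Definition rooted_a : tree_aut :=
  build_tree_aut (map_headK (@ordSK p)) (map_headK (@ord_predK p)) erefl
    (map_head_rcons _) (map_head_rcons _).

(* [directed s] is the automorphism [b] fixing the first level with
   [psi b = s], where an entry [None] of [s] stands for [b] itself. *)
Fixpoint directed_fun (s : seq (option tree_aut)) (w : word) : word :=
  if w is x :: v then
    x :: (if nth None s x is Some f then f v else directed_fun s v)
  else [::].

Lemma directed_funK s :
  cancel (directed_fun s) (directed_fun (map (omap tree_inverse) s)).
Proof.
elim=> [|x v IHv] //=; congr cons.
have [xs|sx] := ltnP x (size s).
  by rewrite (nth_map None) //; case: nth => [f|] //=; exact: tree_funK.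
by rewrite !nth_default ?size_map.
Qed.

Lemma directed_invK s :
  cancel (directed_fun (map (omap tree_inverse) s)) (directed_fun s).
Proof.
elim=> [|x v IHv] //=; congr cons.
have [xs|sx] := ltnP x (size s).
  by rewrite (nth_map None) //; case: nth => [f|] //=; exact: tree_invK.
by rewrite !nth_default ?size_map.
Qed.

Lemma directed_rcons s u x :
  exists y, directed_fun s (rcons u x) = rcons (directed_fun s u) y.
Proof.
elim: u => [|z u [y IHu]] /=.
  by exists x; case: nth => [f|] //; rewrite tree_root.
case: nth => [f|]; last by exists y; rewrite IHu.
by have [y' ->] := tree_aut_rcons f u x; exists y'.
Qed.

Definition directed (s : seq (option tree_aut)) : tree_aut :=
  build_tree_aut (directed_funK s) (directed_invK s) erefl
    (directed_rcons s) (directed_rcons _).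

Lemma directedE s x v :
  directed s (x :: v) = x :: odflt (directed s) (nth None s x) v.
Proof. by rewrite /=; case: nth. Qed.

(* For [e = (e_1, ..., e_(p-1))] this is
   [(a^e_(j+1), ..., a^e_(p-1), b, a^e_1, ..., a^e_j)]: [j : 'I_p] is counted
   from 0 here and from 1 in the usual definition of [b^(j)]. *)
Definition egs_sections (j : 'I_p) (e : 'rV['F_p]_p.-1) :
    seq (option tree_aut) :=
  let c := [seq Some (rooted_a ^+ (e ord0 k : 'F_p)) | k <- enum 'I_p.-1] in
  drop j c ++ None :: take j c.

(* The ranks [r j] range over {0, ..., p - 1}; the rows of [e j] are the
   defining vectors attached to [j]. *)
Definition multi_EGS (G : subgroup tree_aut) : Prop :=
  exists (r : 'I_p -> 'I_p) (e : forall j, 'M['F_p]_(r j, p.-1)),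
    [/\ exists j, (0 < r j)%N,
        forall j, row_free (e j) &
        subgroup_set G = generated
          ([set rooted_a] `|`
           [set b | exists j i, b = directed (egs_sections j (row i (e j)))])].

End Tree.

(* Main.v *)
From HB Require Import structures.
From mathcomp Require Import all_fingroup all_solvable finmap.
Require Import Defs.
From mathcomp Require Import all_boot all_order all_algebra.
From mathcomp Require Import all_classical all_reals all_analysis.

(** For [0 < r < p] let [G_r] be the multi-EGS group generated by [a] and by
    [b_0, ..., b_(r-1)], where [b_i] has sections [b_i] at vertex 0, [a] at
    vertex [i + 1] and 1 elsewhere.  The two groups are [G_1] and [G_2].

    Branching.  Let [c_s] be the conjugate of [b_i] whose section at vertex [x]
    is that of [b_i] at [x + s].  As 0, [i + 1], [2 (i + 1)] are distinct modulo
    [p], [[b_i, c_(i+1)]] has section [[b_i, a]] at vertex 0 and is trivial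
    elsewhere, so [K = G_r'] contains a copy of itself below each vertex; and
    the copy of [K] below some vertex of level 2 lies in [K'].

    Central width.  [t = a b_0] is transitive on every level, since [t ^ p]
    fixes vertex 0 with section [t].  Let [N] be a normal subgroup fixing level
    [n] but not level [n + 1].  Commutators of elements moving a vertex with
    copies of [K] below that vertex show that [[N, G]] contains the product [S]
    of the copies of [K] at level [n + 3].  In the finite group [N / S] the map
    [x |-> [x, t]] has fibres of size [|C(t)|], so [|N : [N, G]| <= |C(t)|]; by
    transitivity of [t] an element of [C(t)] is determined by its section at a
    single vertex of level [n], which bounds [|C(t)|] independently of [N].

    Non-isomorphism.  [G_r] is generated by [r + 1] elements and maps onto
    ['F_p ^ (r + 1)].  The exponent of [b_i] in [g] is well defined because the
    sections of [g] at a deep level are powers of [a] or products of the [b_i],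
    and the sum over a level of the exponents of the sections is independent of
    the (deep) level. *)

Set Implicit Arguments.
Unset Strict Implicit.
Unset Printing Implicit Defensive.

Import Order.TTheory GRing.Theory Num.Theory.

Local Open Scope classical_set_scope.
Local Open Scope group_scope.

(** * Finite quotients of a group *)

Section SubgroupTheory.
Variable U : groupType.
Implicit Types (A B N X : set U) (x y z : U).

Lemma subgroup1 A : is_subgroup A -> A 1.
Proof. by move=> /is_subgroupP[]. Qed.

Lemma subgroupM A x y : is_subgroup A -> A x -> A y -> A (x * y).
Proof. by move=> /is_subgroupP[_ + _]; exact. Qed.

Lemma subgroupV A x : is_subgroup A -> A x -> A x^-1.
Proof. by move=> /is_subgroupP[_ _]; exact. Qed.

Lemma subgroupJ A x y : is_subgroup A -> A x -> A y -> A (x ^ y).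
Proof. by move=> sA Ax Ay; apply: subgroupM (subgroupV _ _) (subgroupM _ _ _).
  Qed.

Lemma subgroupR A x y : is_subgroup A -> A x -> A y -> A [~ x, y].
Proof. by move=> sA Ax Ay; apply: subgroupM (subgroupV _ _) (subgroupJ _ _ _).
  Qed.

Lemma subgroupX A x n : is_subgroup A -> A x -> A (x ^+ n).
Proof.
move=> sA Ax; elim: n => [|n IHn]; first exact: subgroup1.
by rewrite expgS; apply: subgroupM.
Qed.

Lemma subgroupVl A x : is_subgroup A -> A x^-1 -> A x.
Proof. by move=> sA /(subgroupV sA); rewrite invgK. Qed.

Lemma generatedS X A : is_subgroup A -> X `<=` A -> generated X `<=` A.
Proof. exact: smallest_sub. Qed.

Lemma mem_generated X x : X x -> generated X x.
Proof. by move=> Xx; apply: sub_gen_smallest. Qed.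

Definition commutator_subgroup A B : set U :=
  generated [set [~ x, y] | x in A & y in B].

Lemma mem_commutator A B x y : A x -> B y -> commutator_subgroup A B [~ x, y].
Proof. by move=> Ax By; apply: mem_generated; exists x => //; exists y. Qed.

Lemma commutator_subgroupP A B : is_subgroup (commutator_subgroup A B).
Proof. exact: generated_subgroup. Qed.

Lemma eq_lcoset N x y : is_subgroup N ->
  lcoset N x = lcoset N y <-> N (x^-1 * y).
Proof.
move=> sN; split=> [xy|Nxy].
  have [n Nn <-] : lcoset N x y by rewrite xy; exists 1; rewrite ?mulg1 //;
    exact: subgroup1.
  by rewrite mulKg.
apply/seteqP; split=> _ [n Nn <-].
  exists ((x^-1 * y)^-1 * n); first by apply: subgroupM => //; exact: subgroupV.
  by rewrite invgM invgK !mulgA mulgV mul1g.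
exists (x^-1 * y * n); first exact: subgroupM.
by rewrite !mulgA mulgV mul1g.
Qed.

Lemma mem_lcoset N x y : lcoset N x y <-> N (x^-1 * y).
Proof.
split=> [[n Nn <-]|Nxy]; first by rewrite mulKg.
by exists (x^-1 * y); rewrite // mulKVg.
Qed.

(** Each fibre of [f] lies in one coset, so one representative per fibre reaches every coset. *)
Lemma finite_lcosets N (F : finType) (f : U -> F) : is_subgroup N ->
  (forall x y, f x = f y -> N (x^-1 * y)) -> finite_set (lcosets setT N).
Proof.
move=> sN fN.
have repP d : exists x, forall y, f y = d -> f x = d.
  have [[x xd]|nox] := pselect (exists x, f x = d); first by exists x.
  by exists 1 => y yd; case: nox; exists y.
have [rep {}repP] := choice repP.
have finF : finite_set [set: F] by exact: finite_finset.
apply: sub_finite_set (finite_image (fun d => lcoset N (rep d)) finF).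
move=> _ [x _ <-]; exists (f x) => //.
by apply/eq_lcoset => //; apply: fN; exact: repP.
Qed.

End SubgroupTheory.

Section FiniteQuotient.
Variable U : groupType.
Implicit Types (S : finite_index_normal U) (N : set U).

(* [U] acts on the cosets of [S] by left multiplication by the inverse. *)
Lemma finite_quotient S : exists (Q : finGroupType) (f : U -> Q),
  {morph f : x y / x * y} /\ forall x, f x = 1 <-> fin_set S x.
Proof.
have sS := fin_subgroup S; have [X XE] := finite_fsetP.1 (fin_index S).
have Xl g : lcoset S g \in X.
  by have : [set` X] (lcoset S g) by rewrite -XE; exists g.
have memX C : C \in X -> exists g, C = lcoset S g.
  by move=> CX; have : [set` X] C by []; rewrite -XE => -[g _ <-]; exists g.
have shift g h : [set g^-1 * x | x in lcoset S h] = lcoset S (g^-1 * h).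
  apply/seteqP; split=> [_ [_ [n Nn <-] <-]|_ [n Nn <-]].
    by exists n; rewrite ?mulgA.
  by exists (h * n); rewrite ?mulgA //; exists n.
have Xshift g (C : X) : [set g^-1 * x | x in fsval C] \in X.
  by have [h ->] := memX _ (fsvalP C); rewrite shift.
pose F g (C : X) : X := [` Xshift g C]%fset.
have Finj g : injective (F g).
  move=> C D /(congr1 val) /= CD; apply: val_inj.
  have [c cE] := memX _ (fsvalP C); have [d dE] := memX _ (fsvalP D).
  move: CD; rewrite cE dE !shift => /eq_lcoset-/(_ sS) CD.
  by rewrite [val _]cE [val _]dE; apply/eq_lcoset => //; move: CD;
    rewrite invgM invgK !mulgA mulgK.
have FE g (C : X) c : val C = lcoset S c ->
  val (perm (@Finj g) C) = lcoset S (g^-1 * c).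
  by move=> cE; rewrite permE /= [fsval _]cE shift.
(* Permutations compose from left to right, so acting by the inverse gives a morphism. *)
exists {perm X}, (fun g => perm (@Finj g)); split=> [g h|g].
  apply/perm.permP => C; apply: val_inj; have [c cE] := memX _ (fsvalP C).
  rewrite (FE _ _ _ cE) permM.
  by rewrite (FE _ _ _ (FE _ _ _ cE)) invgM mulgA.
split=> [/perm.permP/(_ [` Xl 1]%fset)/(congr1 val)|Sg].
  rewrite (@FE _ _ 1) // perm1 /= => /eq_lcoset-/(_ sS).
  by rewrite !mulg1 invgK.
apply/perm.permP => C; apply: val_inj; have [c cE] := memX _ (fsvalP C).
rewrite (FE _ _ _ cE) perm1 [RHS]cE; apply/eq_lcoset => //.
by rewrite invgM invgK -mulgA; apply: fin_normal.
Qed.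


(** By Cauchy's theorem a prime dividing the order of [U / S] is the order of some element, and all
    these orders are powers of [p]. *)
Lemma index_p_power (p : nat) S : prime p ->
    (forall x, exists k, fin_set S (x ^+ (p ^ k))) ->
  exists n, (lcosets setT S #= `I_(p ^ n))%card.
Proof.
move=> p_pr Sp; have sS := fin_subgroup S.
have [Q [f [fM fker]]] := finite_quotient S.
have f1 : f 1 = 1 by apply/fker; exact: subgroup1.
have fX x n : f (x ^+ n) = f x ^+ n.
  by elim: n => [|n IHn]; rewrite ?expg0 // !expgS fM IHn.
pose I := [set q : Q | `[< exists x, f x = q >]]%SET.
have IP q : q \in I <-> exists x, f x = q by rewrite inE; split=> /asboolP.
have gI : group_set I.
  apply/group_setP; split=> [|c d /IP[x <-] /IP[y <-]]; apply/IP.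
    by exists 1.
  by exists (x * y).
have pI : p.-group (group gI).
  apply/pgroupP => q q_pr /(Cauchy q_pr)[c /= /IP[x <-] fxq].
  have [k /fker] := Sp x; rewrite fX => /eqP; rewrite -order_dvdn fxq.
  by rewrite Euclid_dvdX // dvdn_prime2 // => /andP[/eqP-> _]; rewrite inE.
exists (logn p #|group gI|); rewrite -(card_pgroup pI).
have fE x : f @^-1` [set f x] = lcoset S x.
  apply/seteqP; split=> y; rewrite mem_lcoset -fker fM.
    have -> : f x^-1 = (f x)^-1 by apply/esym/mulg1_eq; rewrite -fM mulgV.
    by move=> /= ->; rewrite mulVg.
  have -> : f x^-1 = (f x)^-1 by apply/esym/mulg1_eq; rewrite -fM mulgV.
  by move=> fxy; rewrite /= -(mulg1 (f x)) -fxy mulKVg.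
have -> : lcosets setT S = (fun c => f @^-1` [set c]) @` [set` enum (group gI)].
  apply/seteqP; split=> [_ [x _ <-]|A [c /=]].
    by exists (f x); rewrite ?fE //= mem_enum; apply/IP; exists x.
  by rewrite mem_enum => /IP[x <-] <-; exists x; rewrite ?fE.
have finj : {in [set` enum (group gI)] &, injective (fun c => f @^-1` [set c])}.
  move=> c d /set_mem; rewrite /= mem_enum => /IP[x <-] _.
  by move=> /seteqP[/(_ x erefl)].
apply: card_eq_trans (inj_card_eq finj) _.
have -> : [set` enum (group gI)] = [set` seq_fset tt (enum (group gI))].
  have E := seq_fsetE tt (enum (group gI)).
  apply/seteqP; split=> c cI; first exact: (etrans (E c) cI).
  exact: (etrans (esym (E c)) cI).
by apply/card_eq_fsetP; rewrite size_seq_fset undup_id ?enum_uniq // -cardE.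
Qed.

(** Counting in [U / S]: the conjugacy class of [t] under [N] has [|N : C_N(t)|] elements and,
    translated by the inverse of [t], lies in [C]. Hence [|N : C| <= |C_N(t)|], and the last
    hypothesis makes [f] injective on representatives of this centraliser. The list [s] consists of
    coset representatives of [C] in [N]. *)
Lemma centraliser_cover S N (t : U) (F : finType) (f : U -> F) (C : set U) :
    is_subgroup N -> is_subgroup C -> S `<=` C -> C `<=` N ->
    (forall x, N x -> C [~ x, t]) ->
    (forall x y, N x -> N y -> fin_set S [~ x^-1 * y, t] ->
       f x = f y -> fin_set S (x^-1 * y)) ->
  exists s : seq U, (size s <= #|F|)%N /\
    forall x, N x -> exists2 g, g \in s & C (g^-1 * x).
Proof.
move=> sN sC SC CN CR fS; have sS := fin_subgroup S.
have [Q [q [qM qker]]] := finite_quotient S.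
have q1 : q 1 = 1 by apply/qker; exact: subgroup1.
have qV x : q x^-1 = (q x)^-1.
  by apply/esym/mulg1_eq; rewrite -qM mulgV.
have qR x y : q [~ x, y] = [~ q x, q y] by rewrite !qM !qV.
pose im (A : set U) := [set c : Q | `[< exists2 x, A x & q x = c >]]%SET.
have imP A c : c \in im A <-> exists2 x, A x & q x = c by rewrite inE; split=>
  /asboolP.
have im_group A : is_subgroup A -> group_set (im A).
  move=> sA; apply/group_setP; split=> [|c d /imP[x Ax <-] /imP[y Ay <-]];
    apply/imP.
    by exists 1 => //; apply: subgroup1.
  by exists (x * y) => //; apply: subgroupM.
pose Nq := group (im_group N sN); pose Cq := group (im_group C sC).
have CNq : Cq \subset Nq.
  by apply/fintype.subsetP => c /imP[x Cx <-]; apply/imP; exists x => //;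
    apply: CN.
have index_le : (#|Nq : Cq| <= #|'C_Nq[q t]|)%N.
  have /subset_leq_card : (q t)^-1 *: (q t ^: Nq) \subset Cq.
    apply/fintype.subsetP => _ /lcosetP[_ /imsetP[_ /imP[x Nx <-] ->] ->].
    apply/imP; exists [~ x, t]^-1; first exact: (subgroupV sC (CR _ Nx)).
    by rewrite qV qR invgR.
  rewrite card_lcoset -index_cent1 => leC.
  have := Lagrange CNq; rewrite -(Lagrange (subsetIl Nq 'C[q t])) => NE.
  have : (#|Cq| * #|Nq : Cq| <= #|Cq| * #|'C_Nq[q t]|)%N.
    by rewrite NE mulnC leq_mul2r leC orbT.
  by rewrite leq_pmul2l.
have C_le : (#|'C_Nq[q t]| <= #|F|)%N.
  have repP c : exists x, c \in 'C_Nq[q t] -> N x /\ q x = c.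
    have [/setIP[/imP[x Nx qx] _]|_] := boolP (c \in 'C_Nq[q t]).
      by exists x.
    by exists 1.
  have [rep {}repP] := choice repP.
  rewrite -(@card_in_imset _ _ (f \o rep)) ?max_card // => c d Cc Cd.
  have [[Nc cE] [Nd dE]] := (repP _ Cc, repP _ Cd).
  have commS : fin_set S [~ (rep c)^-1 * rep d, t].
    apply/qker; rewrite qR qM qV cE dE; apply/eqP/commgP/commute_sym.
    have [/setIP[_ /cent1P tc] /setIP[_ /cent1P td]] := (Cc, Cd).
    by apply: commuteM; [apply: commuteV|]; apply: commute_sym.
  move=> /= /(fS _ _ Nc Nd commS)/qker.
  by rewrite qM qV cE dE => cd; rewrite -(mulg1 c) -cd mulKVg.
have repP (L : {set Q}) : exists x, L \in fingroup.lcosets Cq Nq ->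
  L = (q x *: Cq)%g.
  have [/lcosetsP[_ /imP[x Nx <-] ->]|_] :=
    boolP (L \in fingroup.lcosets Cq Nq).
    by exists x.
  by exists 1.
have [rep {}repP] := choice repP.
exists [seq rep L | L <- enum (fingroup.lcosets Cq Nq)]; split.
  by rewrite size_map -cardE card_lcosets (leq_trans index_le).
move=> x Nx; have Lx : (q x *: Cq)%g \in fingroup.lcosets Cq Nq.
  by apply/lcosetsP; exists (q x) => //; apply/imP; exists x.
exists (rep (q x *: Cq)%g); first by apply/map_f; rewrite mem_enum.
have : q x \in (q (rep (q x *: Cq)) *: Cq)%g by rewrite -repP // lcoset_refl.
move=> /lcosetP[c /imP[y Cy <-]].
move: (rep (q x *: Cq)%g) => g qx.
have : fin_set S (y^-1 * (g^-1 * x)).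
  by apply/qker; rewrite !qM !qV qx mulKg mulVg.
by move=> /SC/(subgroupM sC Cy); rewrite mulKVg.
Qed.
End FiniteQuotient.

(** * The topology of a profinite completion *)

Section CompletionTopology.
Variable G : groupType.
Local Notation pc := (profinite_completion G).
Implicit Types (L M N : finite_index_normal G) (x y : pc) (g h : G).

Lemma finite_index_normal_inhabited : inhabited (finite_index_normal G).
Proof.
have sT : is_subgroup [set: G] by apply/is_subgroupP; split.
have finT : finite_set (lcosets [set: G] setT).
  apply: (@sub_finite_set _ _ [set setT]) => // _ [g _ <-].
  by apply/seteqP; split=> // h _; apply/mem_lcoset.
by constructor; exact: (@FiniteIndexNormal _ setT sT _ finT).
Qed.

Lemma finite_index_normalI M N : exists L, L `<=` M /\ L `<=` N.
Proof.
have [sM sN] := (fin_subgroup M, fin_subgroup N).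
have sI : is_subgroup (M `&` N).
  apply/is_subgroupP; split=> [|x y [Mx Nx] [My Ny]|x [Mx Nx]]; split;
    by [apply: subgroup1 | apply: subgroupM | apply: subgroupV].
have nI : normalised (M `&` N).
  by move=> x y [Mx Nx]; split; apply: fin_normal.
have finI : finite_set (lcosets setT (M `&` N)).
  apply: (sub_finite_set _ (finite_image2 setI (fin_index M) (fin_index N))).
  move=> _ [g _ <-]; exists (lcoset M g); first by exists g.
  exists (lcoset N g); first by exists g.
  apply/seteqP; split=> h; last by move=> [n [Mn Nn] <-]; split; exists n.
  by move=> [/mem_lcoset Mh /mem_lcoset Nh]; apply/mem_lcoset.
by exists (FiniteIndexNormal sI nI finI); split=> x [].
Qed.

Lemma pc_memE x N g : pc_fun x N g <-> pc_fun x N = lcoset N g.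
Proof.
have sN := fin_subgroup N.
have [h ->] := pcE x N; rewrite mem_lcoset; split=> [Nhg|].
  exact/eq_lcoset.
by move=> /eq_lcoset; exact.
Qed.

Lemma pc_fun_subset M N x y : M `<=` N ->
  pc_fun x M = pc_fun y M -> pc_fun x N = pc_fun y N.
Proof.
move=> MN xy; have [g xg] := pcE x M.
have /pc_memE -> : pc_fun x N g by apply: (pc_compat MN); apply/pc_memE.
have /pc_memE -> // : pc_fun y N g by apply: (pc_compat MN); apply/pc_memE;
  rewrite -xy.
Qed.

(** The filter generated by the cylinders converges to [x] by [pc_cvg], hence contains every
    neighbourhood. One index [N] suffices because the system of quotients is directed. *)
Lemma pc_nbhsE x (A : set pc) : nbhs x A ->
  exists N, [set y : pc | pc_fun y N = pc_fun x N] `<=` A.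
Proof.
pose F : set_system pc :=
  [set B | exists N, [set y : pc | pc_fun y N = pc_fun x N] `<=` B].
have FF : Filter F.
  split=> [|P Q [M MP] [N NQ]|P Q PQ [N NP]].
  - by have [N] := finite_index_normal_inhabited; exists N.
  - have [L [LM LN]] := finite_index_normalI M N.
    by exists L => y yx; split; [apply: MP|apply: NQ]; exact: pc_fun_subset yx.
  - by exists N; apply: subset_trans PQ.
have Fx : F --> x by apply: pc_cvg => N; exists N.
exact: Fx.
Qed.

Lemma pc_open_cylinder N (C : set G) : open [set y : pc | pc_fun y N = C].
Proof.
rewrite openE => x xC; rewrite /interior.
by have := pc_nbhs x N; rewrite (xC : pc_fun x N = C).
Qed.

Lemma pc_clopen_cylinder N x : clopen [set y : pc | pc_fun y N = pc_fun x N].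
Proof.
split; first exact: pc_open_cylinder.
rewrite -openC openE => y yx; rewrite /interior.
have FF := nbhs_filter y.
by apply: filterS (pc_nbhs y N) => z zy zx; apply: yx; rewrite /= -zy.
Qed.

Lemma pc_separated x y : x != y -> exists N, pc_fun x N <> pc_fun y N.
Proof.
by move=> /eqP xy; apply: contrapT => /forallNP xyN; apply/xy/pcP => N;
  exact: contrapT.
Qed.

Lemma pc_totally_disconnected : totally_disconnected [set: pc].
Proof.
apply: zero_dimension_totally_disconnected => x y /pc_separated[N xy].
exists [set z : pc | pc_fun z N = pc_fun x N]; split=> //.
  exact: pc_clopen_cylinder.
by move=> /esym.
Qed.

Lemma pc_hausdorff : hausdorff_space pc.
Proof.
rewrite open_hausdorff => x y /pc_separated[N xy].
exists ([set z : pc | pc_fun z N = pc_fun x N],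
  [set z : pc | pc_fun z N = pc_fun y N]).
  by split; apply/mem_set.
split; [exact: pc_open_cylinder|exact: pc_open_cylinder|].
by apply/eqP/seteqP; split=> // z [/= zx zy]; apply: xy; rewrite -zx.
Qed.

(** An ultrafilter picks one of the finitely many cosets in each quotient; the picked cosets are
    compatible and form the limit point. *)
Lemma pc_compact : compact [set: pc].
Proof.
rewrite compact_ultra => F FU _.
have FF : ProperFilter F by exact: ultra_proper.
have FN N : exists C, F [set y : pc | pc_fun y N = C].
  apply: contrapT => /forallNP FC.
  have [X XE] := finite_fsetP.1 (fin_index N).
  have : F (\bigcap_(C in [set` X]) ~` [set y : pc | pc_fun y N = C]).
    by apply: filter_bigI => C _; have [/FC|] :=
      in_ultra_setVsetC [set y : pc | pc_fun y N = C] FU.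
  move=> /filter_ex[y]; rewrite -XE => /(_ _ (pc_coset y N)); exact.
have [f fF] := choice FN.
have f_coset N : lcosets setT N (f N).
  by have [y <-] := filter_ex (fF N); exact: pc_coset.
have f_compat M N : M `<=` N -> f M `<=` f N.
  move=> MN; have [y [/= <- <-]] := filter_ex (filterI (fF M) (fF N)).
  exact: pc_compat.
exists (ProfiniteCompletion f_coset f_compat); split=> //.
exact: pc_cvg.
Qed.

Lemma pc_iota_compat g M N : M `<=` N -> lcoset M g `<=` lcoset N g.
Proof. by move=> MN _ [n Mn <-]; exists n => //; exact: MN. Qed.

Definition pc_iota g : pc :=
  @ProfiniteCompletion _ (fun N => lcoset N g)
    (fun N => imageP (lcoset N) (I : [set: G] g)) (@pc_iota_compat g).

Lemma pc_iotaM : {morph pc_iota : g h / g * h}.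
Proof. by move=> g h; apply: pcP => N /=; rewrite -lcosetM. Qed.

Lemma pc_iota1 : pc_iota 1 = 1.
Proof. by apply: pcP => N /=; rewrite -lcoset1. Qed.

Lemma pc_iotaV g : pc_iota g^-1 = (pc_iota g)^-1.
Proof. by apply/esym/mulg1_eq; rewrite -pc_iotaM mulgV pc_iota1. Qed.

Lemma pc_iotaR g h : pc_iota [~ g, h] = [~ pc_iota g, pc_iota h].
Proof. by rewrite !pc_iotaM !pc_iotaV. Qed.

(** Density of the image of [G], one finite quotient at a time. *)
Lemma pc_dense x N : exists g, pc_fun (pc_iota g^-1 * x) N = fin_set N.
Proof.
have [g xg] := pcE x N; exists g.
by rewrite [LHS]/= xg lcosetM mulVg -lcoset1.
Qed.

(* The kernel of the projection of the completion onto [G / S] is the closure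
   of [S]. *)
Lemma pc_closed_kernel (S : finite_index_normal G) (C : set pc) x : closed C ->
    (forall g, fin_set S g -> C (pc_iota g)) ->
  pc_fun x S = fin_set S -> C x.
Proof.
move=> Ccl SC xS; apply: Ccl => A /pc_nbhsE[N NA].
have [L [LN LS]] := finite_index_normalI N S.
have [g xg] := pcE x L; exists (pc_iota g); split.
  apply: SC; rewrite -xS; apply: (pc_compat LS).
  by apply/pc_memE.
by apply: NA; apply: (pc_fun_subset LN); rewrite xg.
Qed.

(** * Open normal subgroups of the completion and their traces on [G] *)

Section OpenNormal.
Variable D : set pc.
Hypothesis D_open : open_normal_subgroup D.
Let sD : is_subgroup D. Proof. by case: D_open. Qed.

Definition pc_trace : set G := [set g | D (pc_iota g)].

Lemma open_normal_kernel : exists N : finite_index_normal G,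
  forall x, pc_fun x N = fin_set N -> D x.
Proof.
have [_ _] := D_open; rewrite openE => /(_ _ (subgroup1 sD))/pc_nbhsE[N ND].
by exists N.
Qed.

(** An open [D] contains the kernel of some projection to [G / N], so its trace contains [N]. *)
Lemma pc_trace_finite_index : exists N : finite_index_normal G,
    fin_set N = pc_trace.
Proof.
have [N ND] := open_normal_kernel.
have sT : is_subgroup pc_trace.
  apply/is_subgroupP; split=> [|g h|g]; rewrite /pc_trace /mkset.
  - by rewrite pc_iota1; exact: subgroup1.
  - by rewrite pc_iotaM; exact: subgroupM.
  - by rewrite pc_iotaV; exact: subgroupV.
have nT : normalised pc_trace.
  move=> g h Dg; rewrite /pc_trace /mkset !pc_iotaM pc_iotaV.
  by have [_ nD _] := D_open; exact: nD.
have NT : N `<=` pc_trace.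
  move=> g Ng; apply: ND; apply/esym; rewrite lcoset1.
  by apply/eq_lcoset; [exact: fin_subgroup|rewrite invg1 mul1g].
have fT : finite_set (lcosets setT pc_trace).
  apply: sub_finite_set (finite_image (fun A => [set h | exists2 g,
    A g & pc_trace (g^-1 * h)]) (fin_index N)).
  move=> _ [g _ <-]; exists (lcoset N g); first by exists g.
  apply/seteqP; split=> h.
    move=> [_ [n Nn <-]]; rewrite mem_lcoset invgM -mulgA => nh.
    by have := subgroupM sT (NT _ Nn) nh; rewrite mulKVg.
  move=> /mem_lcoset gh; exists g => //; apply/mem_lcoset.
  by rewrite mulVg; apply: subgroup1 (fin_subgroup N).
by exists (FiniteIndexNormal sT nT fT).
Qed.

Lemma pc_open_split x : exists g, D (pc_iota g^-1 * x).
Proof.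
have [N ND] := open_normal_kernel; have [g gx] := pc_dense x N.
by exists g; exact: ND.
Qed.

(** By density every coset of [D] is represented by an element of [G], so [A |-> A D] is a bijection
    between the two sets of cosets. *)
Lemma pc_lcosets_card (N : finite_index_normal G) n : fin_set N = pc_trace ->
  (lcosets setT N #= `I_n)%card -> (lcosets setT D #= `I_n)%card.
Proof.
move=> NE; have sN := fin_subgroup N; apply: card_eq_trans.
pose F (A : set G) : set pc := [set y | exists2 g, A g & D (pc_iota g^-1 * y)].
have FE g : F (lcoset N g) = lcoset D (pc_iota g).
  apply/seteqP; split=> y.
    move=> [_ [n0 + <-]]; rewrite NE => Nn;
      rewrite invgM pc_iotaM -mulgA pc_iotaV => ny.
    by apply/mem_lcoset; have := subgroupM sD Nn ny; rewrite mulKVg pc_iotaV.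
  move=> /mem_lcoset gy; exists g; last by rewrite pc_iotaV.
  by apply/mem_lcoset; rewrite mulVg; exact: subgroup1.
have -> : lcosets setT D = F @` lcosets setT N.
  apply/seteqP; split=> A; last by move=> [_ [g _ <-] <-]; exists (pc_iota g).
  move=> [x _ <-]; have [g gx] := pc_open_split x.
  exists (lcoset N g); first by exists g.
  by rewrite FE; apply/eq_lcoset => //; rewrite -pc_iotaV.
apply: inj_card_eq => A B /set_mem[g _ <-] /set_mem[h _ <-].
rewrite !FE => /eq_lcoset-/(_ sD); rewrite -pc_iotaV -pc_iotaM => gh.
by apply/eq_lcoset; rewrite // NE.
Qed.

Lemma closed_commutator_subgroup (A B : set pc) : is_subgroup
    (closed_commutator A B).
Proof. by apply: smallest_subgroup => K []. Qed.

Lemma closed_commutator_closed (A B : set pc) : closed (closed_commutator A B).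
Proof. by apply: closed_bigI => K [[]]. Qed.

Lemma mem_closed_commutator (A B : set pc) x y : A x -> B y ->
    closed_commutator A B [~ x, y].
Proof. by move=> Ax By; apply: sub_gen_smallest; exists x => //; exists y. Qed.

(** The closed subgroup [C] contains the image of [[N, G]], hence that of [S], hence the kernel of
    the projection to [G / S]. Modulo [C] every element of [D] comes from [N], so representatives of
    [N / [N, G]] suffice. *)
Lemma pc_lcosets_commutator (N S : finite_index_normal G) (s : seq G) :
    fin_set N = pc_trace -> S `<=` commutator_subgroup N setT ->
    (forall g, fin_set N g -> exists2 h,
      h \in s & commutator_subgroup N setT (h^-1 * g)) ->
  lcosets D (closed_commutator D setT) `<=`
    (fun i => lcoset (closed_commutator D setT) (pc_iota (nth 1 s i))) @`
      `I_(size s).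
Proof.
move=> NE SC sN _ [x Dx <-]; set C := closed_commutator _ _.
have sC : is_subgroup C := closed_commutator_subgroup _ _.
have CC g : commutator_subgroup N setT g -> C (pc_iota g).
  have sC' : is_subgroup [set g | C (pc_iota g)].
    apply/is_subgroupP; split=> [|g0 h|g0] /=.
    - by rewrite pc_iota1; exact: subgroup1.
    - by rewrite pc_iotaM; exact: subgroupM.
    - by rewrite pc_iotaV; exact: subgroupV.
  apply: (generatedS sC') => _ [h Nh [k _ <-]] /=.
  by rewrite pc_iotaR; apply: mem_closed_commutator => //; move: Nh; rewrite NE.
have [L LD] := open_normal_kernel.
have [K [KL KS]] := finite_index_normalI L S.
have kerK y : pc_fun y K = fin_set K -> C y /\ D y.
  move=> yK; have yle M : K `<=` M -> pc_fun y M = fin_set M.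
    by move=> KM; have := @pc_fun_subset _ _ y 1 KM; rewrite /= yK => ->.
  split; last by apply/LD/yle.
  have Ccl : closed C by exact: closed_commutator_closed.
  by apply: (pc_closed_kernel Ccl _ (yle _ KS)) => g Sg;
    exact: (CC _ (SC _ Sg)).
(* As [K] lies in both [L] and [S], the quotient of [x] by the image of [g] is in [D] and in [C]. *)
have [g gx] := pc_dense x K; have [Cgx Dgx] := kerK _ gx.
have Ng : fin_set N g.
  rewrite NE; have := subgroupM sD Dx (subgroupV sD Dgx).
  by rewrite invgM pc_iotaV invgK mulKVg.
have [h hs hg] := sN g Ng.
exists (index h s); first by rewrite /= index_mem.
rewrite nth_index //; apply/eq_lcoset => //.
have := subgroupM sC (CC _ hg) Cgx.
by rewrite pc_iotaM !pc_iotaV -mulgA mulKVg.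
Qed.
End OpenNormal.

(** The number [m] bounds [|N : [N, G]|] for all [N] at once, so it bounds every index in the
    definition of the central width. *)
Theorem completion_finite_central_width (R : realType) (p m : nat) : prime p ->
    (forall N, exists n, (lcosets setT N #= `I_(p ^ n))%card) ->
    (forall N, exists S : finite_index_normal G,
      S `<=` commutator_subgroup N setT /\
       exists s : seq G, (size s <= m)%N /\
       forall g, fin_set N g -> exists2 h,
         h \in s & commutator_subgroup N setT (h^-1 * g)) ->
  finite_central_width pc R p.
Proof.
move=> p_pr pN sN; split.
  split; [exact: pc_compact|exact: pc_hausdorff|exact:
    pc_totally_disconnected|].
  move=> D oD; have [N NE] := pc_trace_finite_index oD.
  by have [n Nn] := pN N; exists n; exact: pc_lcosets_card Nn.
have lnp : (0 < ln (p%:R : R))%R by rewrite ln_gt0 // ltr1n prime_gt1.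
(* With [m.+1] in place of [m] the argument of the logarithm is visibly positive. *)
apply: (@le_lt_trans _ _ ((ln m.+1%:R) * (ln p%:R)^-1)%:E);
  last by rewrite ltry.
apply: ge_ereal_sup => _ [D oD <-].
rewrite EFinM -lne_EFin ?ltr0n //.
apply: lee_wpmul2r; first by rewrite lee_fin invr_ge0 ltW.
have [N NE] := pc_trace_finite_index oD.
have [S [SC [s [sm ss]]]] := sN N.
have := pc_lcosets_commutator oD NE SC ss.
set A := lcosets _ _ => As.
have Am : (A #<= `I_m.+1)%card.
  apply: card_le_trans (subset_card_le As) _.
  apply: card_le_trans (card_image_le _ _) _.
  by rewrite card_le_II (leq_trans sm).
have finA : finite_set A by apply: sub_finite_set As (finite_image _ _).
rewrite lee_lne ?in_itv /= ?leey ?andbT ?lee_fin ?ler0n //.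
  by rewrite /subgroup_index /counting asboolT // lee_fin ler_nat
    geq_card_fset_set.
by rewrite /subgroup_index /counting asboolT // lee_fin ler0n.
Qed.
End CompletionTopology.

(** * Sections of tree automorphisms *)

Section Sections.
Variable p : nat.
Local Notation T := (tree_aut p).
Implicit Types (f g h k : T) (x y : 'I_p) (u v w : seq 'I_p).

Definition root_perm f x : 'I_p := head x (f [:: x]).

Lemma tree_size f u : size (f u) = size u.
Proof.
elim/last_ind: u => [|u x IHu]; first by rewrite tree_root.
by have [y ->] := tree_aut_rcons f u x; rewrite !size_rcons IHu.
Qed.

(** Automorphisms respect extension at the right end of a word; induction from that end shows that
    the first letter of the image depends on [x] only. *)
Lemma tree_cons f x v : f (x :: v) = root_perm f x :: behead (f (x :: v)).
Proof.
elim/last_ind: v => [|v y IHv].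
  by rewrite /root_perm; case: (f [:: x]) (tree_size f [:: x]).
have [z] := tree_aut_rcons f (x :: v) y; rewrite rcons_cons => ->.
by rewrite IHv.
Qed.

Definition section_fun f x v := behead (f (x :: v)).

Lemma section_funK f x : cancel (section_fun f x) (section_fun f^-1 (root_perm
    f x)).
Proof.
move=> v; rewrite /section_fun -tree_cons.
by rewrite (_ : (f^-1 : T) (f (x :: v)) = x :: v) //; exact: tree_funK.
Qed.

Lemma root_permK f x : root_perm f^-1 (root_perm f x) = x.
Proof.
have := tree_cons f^-1 (root_perm f x) (behead (f [:: x])); rewrite -tree_cons.
by rewrite (_ : (f^-1 : T) (f [:: x]) = [:: x]) /=; [case|exact: tree_funK].
Qed.

Lemma section_fun_invK f x : cancel (section_fun f^-1 (root_perm f x))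
    (section_fun f x).
Proof. by have := @section_funK f^-1 (root_perm f x);
  rewrite invgK root_permK. Qed.

Lemma section_fun_rcons f x u y : exists z,
    section_fun f x (rcons u y) = rcons (section_fun f x u) z.
Proof.
have [z] := tree_aut_rcons f (x :: u) y; rewrite rcons_cons => fE.
by exists z; rewrite /section_fun fE tree_cons.
Qed.

Lemma section_fun_root f x : section_fun f x [::] = [::].
Proof. by apply: size0nil; rewrite /section_fun size_behead tree_size. Qed.

Definition sec f x : T :=
  build_tree_aut (@section_funK f x) (@section_fun_invK f x) (section_fun_root
    f x)
    (section_fun_rcons f x) (section_fun_rcons _ _).

Lemma treeE f x v : f (x :: v) = root_perm f x :: sec f x v.
Proof. by rewrite tree_cons. Qed.

(** The tool for computing sections: it is enough to write [f] on the words that begin with [x]. *)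
Lemma section_unique f g x y : (forall v, f (x :: v) = y :: g v) ->
    root_perm f x = y /\ sec f x = g.
Proof.
move=> fE; have [<- _] : root_perm f x :: sec f x [::] = y :: g [::] by rewrite
  -treeE fE.
by split=> //; apply: tree_autP => v; have := fE v; rewrite treeE => -[_].
Qed.

Lemma tree_ext f g : root_perm f =1 root_perm g -> sec f =1 sec g -> f = g.
Proof.
move=> fg fgs; apply: tree_autP => -[|x v]; first by rewrite !tree_root.
by rewrite !treeE fg fgs.
Qed.

Lemma root_permM f g x : root_perm (f * g) x = root_perm g (root_perm f x).
Proof. by apply: (section_unique (g := sec f x * sec g (root_perm f x)) _).1 =>
  v /=; rewrite treeE treeE. Qed.

Lemma sectionM f g x : sec (f * g) x = sec f x * sec g (root_perm f x).
Proof. by apply: (section_unique (y := root_perm g (root_perm f x)) _).2 =>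
  v /=; rewrite treeE treeE. Qed.

Lemma root_perm1 x : root_perm 1 x = x. Proof. by []. Qed.

Lemma section1 x : sec 1 x = 1.
Proof. by apply: tree_autP. Qed.

Lemma root_permVK f x : root_perm f (root_perm f^-1 x) = x.
Proof. by rewrite -root_permM mulVg. Qed.

Lemma sectionV f x : sec f^-1 (root_perm f x) = (sec f x)^-1.
Proof. by apply/esym/mulg1_eq; rewrite -sectionM mulgV section1. Qed.

Fixpoint word_sec f u : T := if u is x :: v then word_sec (sec f x) v else f.

Lemma word_section_cat f u v : word_sec f (u ++ v) = word_sec (word_sec f u) v.
Proof. by elim: u f => [|x u IHu] f //=. Qed.

Lemma tree_cat f u v : f (u ++ v) = f u ++ word_sec f u v.
Proof.
by elim: u f => [|x u IHu] f /=; rewrite ?tree_root // !treeE IHu.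
Qed.

Lemma word_sectionM f g u : word_sec (f * g) u = word_sec f u * word_sec g (f
    u).
Proof.
by elim: u f g => [|x u IHu] f g /=; rewrite ?tree_root // sectionM IHu treeE.
Qed.

Lemma word_section1 u : word_sec 1 u = 1.
Proof. by elim: u => //= x u; rewrite section1. Qed.

Lemma word_sectionV f u : word_sec f^-1 (f u) = (word_sec f u)^-1.
Proof. by apply/esym/mulg1_eq; rewrite -word_sectionM mulgV word_section1. Qed.

Lemma treeM f g u : (f * g) u = g (f u). Proof. by []. Qed.

Lemma treeK f u : f^-1 (f u) = u. Proof. exact: tree_funK. Qed.

Lemma treeVK f u : f (f^-1 u) = u. Proof. exact: tree_invK. Qed.

(** * Copies of an automorphism below a vertex *)

Definition delta1_fun x k w : seq 'I_p :=
  if w is y :: v then y :: (if y == x then k v else v) else [::].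

Lemma delta1_funK x k : cancel (delta1_fun x k) (delta1_fun x k^-1).
Proof. by move=> [|y v] //=; case: (y == x); rewrite // tree_funK. Qed.

Lemma delta1_invK x k : cancel (delta1_fun x k^-1) (delta1_fun x k).
Proof. by move=> [|y v] //=; case: (y == x); rewrite // tree_invK. Qed.

Lemma delta1_rcons x k u y : exists z,
    delta1_fun x k (rcons u y) = rcons (delta1_fun x k u) z.
Proof.
case: u => [|t u] /=; first by exists y; rewrite tree_root if_same.
case: (t == x); last by exists y.
by have [z ->] := tree_aut_rcons k u y; exists z.
Qed.

(** Its image under psi has [k] at [x] and 1 elsewhere; [delta] iterates this along a word. *)
Definition delta1 x k : T :=
  build_tree_aut (delta1_funK x k) (delta1_invK x k) erefl
    (delta1_rcons x k) (delta1_rcons x _).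

Lemma root_perm_delta1 x k y : root_perm (delta1 x k) y = y. Proof. by []. Qed.

Lemma section_delta1 x k y : sec (delta1 x k) y = if y == x then k else 1.
Proof.
apply: (section_unique (y := y) _).2 => v /=.
by case: (y == x).
Qed.

Lemma delta1M x : {morph delta1 x : f g / f * g}.
Proof.
move=> f g; apply: tree_ext => y; first by rewrite root_permM.
by rewrite sectionM !section_delta1; case: (y == x); rewrite ?mulg1.
Qed.

Lemma delta1_one x : delta1 x 1 = 1.
Proof. by apply: tree_ext => y //; rewrite section_delta1 section1 if_same. Qed.

Lemma delta1V x f : delta1 x f^-1 = (delta1 x f)^-1.
Proof. by apply/esym/mulg1_eq; rewrite -delta1M mulgV delta1_one. Qed.

Lemma delta1J x k g : delta1 x k ^ g = delta1 (root_perm g x) (k ^ sec g x).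
Proof.
(* Multiplying by [g] on the left removes the inverse from the conjugate. *)
apply: (mulgI g); rewrite -conjgC; apply: tree_ext => y;
  first by rewrite !root_permM.
rewrite !sectionM root_perm_delta1 !section_delta1 (inj_eq (can_inj
  (@root_permK g))).
by case: eqP => [->|_]; rewrite ?mul1g ?mulg1 // -conjgC.
Qed.

Definition delta u k : T := foldr delta1 k u.

Lemma delta_cat u v k : delta (u ++ v) k = delta u (delta v k).
Proof. exact: foldr_cat. Qed.

Lemma deltaM u : {morph delta u : f g / f * g}.
Proof. by move=> f g; elim: u => //= x u ->; rewrite delta1M. Qed.

Lemma delta_one u : delta u 1 = 1.
Proof. by elim: u => //= x u ->; rewrite delta1_one. Qed.

Lemma deltaV u f : delta u f^-1 = (delta u f)^-1.
Proof. by apply/esym/mulg1_eq; rewrite -deltaM mulgV delta_one. Qed.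

Lemma deltaR u f g : delta u [~ f, g] = [~ delta u f, delta u g].
Proof. by rewrite !deltaM !deltaV. Qed.

Lemma deltaJ u k g : delta u k ^ g = delta (g u) (k ^ word_sec g u).
Proof.
elim: u g => [|x u IHu] g /=; first by rewrite tree_root.
by rewrite delta1J IHu treeE.
Qed.

(** The subtrees below distinct vertices of one level are disjoint. *)
Lemma delta_commute u v k l : size u = size v -> u != v ->
    commute (delta u k) (delta v l).
Proof.
elim: u v => [|x u IHu] [|y v] //= [uv]; rewrite eqseq_cons negb_and /commute.
have [<- /=|xy _] := eqVneq x y.
  by move=> /(IHu _ uv) klC; rewrite -!delta1M klC.
apply: tree_ext => z; first by rewrite !root_permM.
rewrite !sectionM !root_perm_delta1 !section_delta1.
by have [->|_] := eqVneq z x; rewrite ?(negPf xy) ?mulg1 ?mul1g.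
Qed.

(** For a subgroup [A] this is the direct product of the copies of [A] below the vertices of level
    [n]. *)
Definition level_subgroup n (A : set T) : set T :=
  [set g : T | forall u, size u = n -> g u = u /\ A (word_sec g u)].

Lemma level_subgroup_add m n A : level_subgroup (n + m) A = level_subgroup n
    (level_subgroup m A).
Proof.
apply/seteqP; split=> g gA u.
  move=> un; have gu : g u = u.
    (* Words of length [n] are padded to length [n + m] with some letter; over an empty alphabet
       only the root exists. *)
    have [x _|T0] := pickP (fun _ : 'I_p => true); last first.
      by case: u un => [|x u]; [rewrite tree_root|have := T0 x].
    have /gA[+ _] : size (u ++ nseq m x) = (n + m)%N by rewrite size_cat un
      size_nseq.
    by rewrite tree_cat => /eqP; rewrite eqseq_cat ?tree_size // => /andP[/eqP].
  split=> // v vm; have /gA : size (u ++ v) = (n + m)%N by rewrite size_cat un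
    vm.
  rewrite tree_cat word_section_cat gu => -[/eqP].
  by rewrite eqseq_cat // eqxx => /eqP.
move=> unm; rewrite -(cat_take_drop n u).
have /gA[gu /(_ (drop n u))] : size (take n u) = n.
  by rewrite size_takel // unm leq_addr.
rewrite size_drop unm addKn => /(_ erefl)[gu' Au].
by rewrite tree_cat word_section_cat gu gu'.
Qed.

Lemma level_subgroup_subgroup n A : is_subgroup A ->
    is_subgroup (level_subgroup n A).
Proof.
move=> sA; apply/is_subgroupP; split=> [u _|f g fA gA u un|f fA u un].
- by rewrite word_section1; split=> //; apply: subgroup1.
- have [[fu Af] [gu Ag]] := (fA u un, gA u un).
  by rewrite treeM word_sectionM fu gu; split=> //; apply: subgroupM.
- have [fu Af] := fA u un; split; first by rewrite -{1}fu treeK.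
  by rewrite -{1}fu word_sectionV; apply: subgroupV.
Qed.

(** An element fixing level [n] is the finite product of the copies of its sections at that
    level. *)
Lemma level_subgroup_generate n (K A : set T) : is_subgroup K ->
    is_subgroup A ->
    (forall u k, size u = n -> K k -> A (delta u k)) ->
      level_subgroup n K `<=` A.
Proof.
move=> sK; elim: n A => [|n IHn] A sA KA g gK.
  by have [_] := gK [::] erefl; apply: (KA [::]).
have {}IHn x h : level_subgroup n K h -> A (delta1 x h).
  have sAx : is_subgroup [set h | A (delta1 x h)].
    apply/is_subgroupP; split=> [|f1 f2|f1] /=;
      rewrite ?delta1_one ?delta1M ?delta1V.
    - exact: subgroup1.
    - exact: subgroupM.
    - exact: subgroupV.
  by apply: (IHn _ sAx) => u k un Kk; apply: (KA (x :: u)); rewrite //= un.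
have : (forall x, root_perm g x = x) /\ (forall x,
  level_subgroup n K (sec g x)).
  have gx x v : size v = n -> root_perm g x = x /\ (sec g x v = v /\
    K (word_sec (sec g x) v)).
    by move=> vn; have [|] := gK (x :: v); rewrite /= ?vn // treeE => -[-> ->].
  split=> [x|x v vn]; last by have [] := gx x v vn.
  by have [|//] := gx x (nseq n x); rewrite size_nseq.
(* The first-level sections are split off one by one; the list holds the vertices where the section
   may still be nontrivial. *)
have : forall x, x \notin enum 'I_p -> sec g x = 1 by move=> x;
  rewrite mem_enum.
elim: (enum 'I_p) g {gK} => [|x s IHs] g gs [gtop gsec].
  rewrite (_ : g = 1); first exact: subgroup1.
  by apply: tree_ext => y; rewrite ?gtop // gs // section1.
rewrite -(mulKVg (delta1 x (sec g x)) g); apply: (subgroupM sA);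
  first exact: IHn.
have secE y : sec ((delta1 x (sec g x))^-1 * g) y = if y == x then 1 else sec g
  y.
  rewrite -delta1V sectionM section_delta1 root_perm_delta1.
  by have [->|_] := eqVneq y x; rewrite ?mulVg ?mul1g.
apply: IHs => [y ys|].
  by rewrite secE; case: eqVneq => // yx; apply: gs; rewrite in_cons negb_or yx.
split=> y; first by rewrite -delta1V root_permM root_perm_delta1.
rewrite secE; case: (y == x) => //.
by apply: subgroup1; exact: level_subgroup_subgroup.
Qed.

End Sections.

(** * A criterion for finite central width *)

Section Lift.
Variables (U : groupType) (G : subgroup U).
Implicit Types (x y : subgroup_type G).

Lemma subgroup_lift g : subgroup_set G g -> exists x : subgroup_type G,
    val x = g.
Proof. by move=> Gg; exists (Sub g (mem_set Gg)). Qed.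

Lemma subgroup_valP x : subgroup_set G (val x).
Proof. exact: set_mem (valP x). Qed.

Lemma subgroup_setP : is_subgroup (subgroup_set G).
Proof. exact: subgroup_closed. Qed.

Lemma subgroup_valX x n : val (x ^+ n) = val x ^+ n.
Proof. exact: gmulfXn. Qed.

Lemma subgroup_valR x y : val [~ x, y] = [~ val x, val y].
Proof. exact: gmulfR. Qed.

End Lift.

Section Criterion.
(** The setting is a self-similar group [G] with a branching subgroup [K] whose copy below [w0] lies
    in [K']. The colouring [c] separates the cosets of [K] in [G], which bounds their number by
    [nc]; [t] is transitive on every level. *)
Variables (p : nat) (G : subgroup (tree_aut p)) (K : set (tree_aut p)).
Variables (t : tree_aut p) (x0 : 'I_p) (w0 : seq 'I_p) (e : nat).
Variables (nc : nat) (c : tree_aut p -> 'I_nc).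
Local Notation T := (tree_aut p).
Local Notation GT := (subgroup_type G).
Local Notation gset := (subgroup_set G).
Implicit Types (g h k : T) (u v w : seq 'I_p) (x y : GT).
Hypothesis p_pr : prime p.
Hypothesis G_section : forall g (x : 'I_p), gset g -> gset (sec g x).
Hypothesis G_root_perm : forall g (x : 'I_p), gset g ->
  root_perm (g ^+ p) x = x.
Hypothesis sK : is_subgroup K.
Hypothesis KG : K `<=` gset.
Hypothesis K_norm : forall k g, K k -> gset g -> K (k ^ g).
Hypothesis K_delta : forall (x : 'I_p) k, K k -> K (delta1 x k).
Hypothesis K_comm : forall k, K k -> commutator_subgroup K K (delta w0 k).
Hypothesis K_exp : forall g, gset g -> K (g ^+ (p ^ e)).
Hypothesis cK : forall g h, gset g -> gset h -> c g = c h -> K (g^-1 * h).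
Hypothesis Gt : gset t.
Hypothesis t_trans : forall u, exists i, (t ^+ i) (nseq (size u) x0) = u.

Let sG : is_subgroup gset. Proof. exact: subgroup_setP. Qed.

Lemma K_delta_word u k : K k -> K (delta u k).
Proof. by elim: u => //= x u IHu /IHu; exact: K_delta. Qed.

Lemma G_word_section g u : gset g -> gset (word_sec g u).
Proof. by elim: u g => //= x u IHu g Gg; apply/IHu/G_section. Qed.

Lemma word_sectionJ g h u : g u = u ->
    word_sec (g ^ h) (h u) = word_sec g u ^ word_sec h u.
Proof. by move=> gu; rewrite word_sectionM word_sectionV treeK word_sectionM
  gu. Qed.

Lemma level_subgroup_norm n g h : level_subgroup n K g -> gset h ->
    level_subgroup n K (g ^ h).
Proof.
move=> gK Gh u; rewrite -(treeVK h u) tree_size => un.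
have [gu Ku] := gK _ un; rewrite word_sectionJ //; split;
  last exact/K_norm/G_word_section.
by rewrite treeM treeK treeM gu.
Qed.

Lemma word_sectionX g u i : g u = u -> (g ^+ i) u = u /\
    word_sec (g ^+ i) u = word_sec g u ^+ i.
Proof.
move=> gu; elim: i => [|i [IHi IHs]]; first by rewrite !expg0 word_section1.
by rewrite !expgS treeM word_sectionM gu IHi IHs.
Qed.

(** The power [g ^ p] fixes the first level and its sections lie in [G] again, so the argument
    repeats [n] times. *)
Lemma level_subgroup_expn n g : gset g -> level_subgroup n gset (g ^+ (p ^ n)).
Proof.
elim: n g => [|n IHn] g Gg; first by case=> //; rewrite tree_root expg1.
case=> // x u /= [un].
rewrite expnS expgnA.
have gp_fix : (g ^+ p) [:: x] = [:: x].
  by rewrite treeE G_root_perm // tree_root.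
have [fx /= secE] := word_sectionX (p ^ n) gp_fix.
have topE : root_perm ((g ^+ p) ^+ (p ^ n)) x = x by move: fx; rewrite treeE =>
  -[].
have Gx : gset (sec (g ^+ p) x) by apply: G_section; exact: subgroupX.
have [fixu Gu] := IHn _ Gx u un.
by rewrite treeE topE secE fixu.
Qed.

Lemma level_subgroup_expK n g : gset g ->
    level_subgroup n K (g ^+ (p ^ (n + e))).
Proof.
move=> Gg u un; have [fu Gu] := level_subgroup_expn Gg un.
rewrite expnD expgnA; have [-> ->] := word_sectionX (p ^ e) fu.
by split=> //; exact: K_exp.
Qed.

(** A finite invariant separating the cosets of [level_subgroup n K] in [G]: the action on level [n]
    and the colours of the sections there. *)
Definition level_data n (g : T) : {ffun n.-tuple 'I_p ->
    n.-tuple 'I_p * 'I_nc} :=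
  [ffun u : n.-tuple _ => (insubd u (g u), c (word_sec g u))].

Lemma level_dataP n g h : gset g -> gset h -> level_data n g = level_data n h ->
  level_subgroup n K (g^-1 * h).
Proof.
move=> Gg Gh gh u; have [v ->] : exists v, u = g v by exists (g^-1 u);
  rewrite treeVK.
rewrite tree_size => vn; have /eqP vnT := vn.
move/ffunP/(_ (Tuple vnT)): gh; rewrite !ffunE => -[gvE cE].
have {}gvE : g v = h v.
  by move/(congr1 val): gvE; rewrite !val_insubd /= !tree_size vn eqxx.
split; first by rewrite treeM treeK gvE.
by rewrite word_sectionM word_sectionV treeK; apply: cK => //;
  exact: G_word_section.
Qed.

Definition level_subset n : set GT := [set x | level_subgroup n K (val x)].

Lemma level_subset_subgroup n : is_subgroup (level_subset n).
Proof.
have sL := level_subgroup_subgroup n sK.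
apply/is_subgroupP; split=> [|x y|x]; rewrite /level_subset /mkset.
- by rewrite val1; exact: subgroup1.
- by rewrite valM; exact: subgroupM.
- by rewrite gmulfV; exact: subgroupV.
Qed.

Lemma level_subset_normal n : normalised (level_subset n).
Proof.
move=> x y Lx; rewrite /level_subset /mkset gmulfJ.
by apply: level_subgroup_norm => //; exact: subgroup_valP.
Qed.

Lemma level_subset_finite n : finite_set (lcosets setT (level_subset n)).
Proof.
apply: (finite_lcosets (f := fun x : GT => level_data n (val x))).
  exact: level_subset_subgroup.
move=> x y; rewrite /level_subset /mkset valM gmulfV => xy.
by apply: level_dataP => //; exact: subgroup_valP.
Qed.

Definition level_normal_subgroup n : finite_index_normal GT :=
  FiniteIndexNormal (level_subset_subgroup n) (@level_subset_normal n)
    (level_subset_finite n).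

(** If [t ^ q = 1], then [t] has at most [q] powers, too few to reach the [p ^ q] vertices of level
    [q]. *)
Lemma t_infinite_order q : (0 < q)%N -> t ^+ q <> 1.
Proof.
move=> q_gt0 tq; have q_pos : (0 < #|'I_q|)%N by rewrite card_ord.
have iP (u : q.-tuple 'I_p) : exists i : 'I_q, (t ^+ i) (nseq q x0) = u.
  have [i] := t_trans u; rewrite size_tuple => iu.
  exists (Ordinal (ltn_pmod i q_gt0)); rewrite -iu /= {2}(divn_eq i q).
  by rewrite expgnDr mulnC expgnA tq expg1n mul1g.
have [i {}iP] := choice iP.
have /leq_card : injective i.
  by move=> u v uv; apply: val_inj; rewrite /= -(iP u) -(iP v) uv.
by rewrite card_tuple !card_ord leqNgt ltn_expl // prime_gt1.
Qed.

(** Some power of [t] with positive exponent lies in [N], and it is nontrivial as [t] has infinite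
    order. *)
Lemma t_power_mem (N : finite_index_normal GT) :
  exists2 x : GT, fin_set N x & exists w, val x w <> w.
Proof.
have [t' t'E] := subgroup_lift Gt.
have [Q [q [qM qker]]] := finite_quotient N.
have q1 : q 1 = 1 by apply/qker; exact: subgroup1 (fin_subgroup N).
have qX n : q (t' ^+ n) = q t' ^+ n.
  by elim: n => [|n IHn]; rewrite ?expg0 // !expgS qM IHn.
exists (t' ^+ #[q t']); first by apply/qker; rewrite qX expg_order.
apply: contrapT => /forallNP xw; apply: (@t_infinite_order #[q t']) => //.
apply: tree_autP => w; have /contrapT := xw w.
by rewrite subgroup_valX t'E.
Qed.

(** * Commutators of [G] with a normal subgroup of finite index *)

Section NormalSubgroup.
Variable N : finite_index_normal GT.
Let sN : is_subgroup N. Proof. exact: fin_subgroup. Qed.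
Let C := commutator_subgroup (fin_set N) setT.
Let sC : is_subgroup C. Proof. exact: commutator_subgroupP. Qed.
Let D : set T := val @` C.

Lemma commutator_sub_N : C `<=` N.
Proof.
apply: generatedS => // _ [x Nx [y _ <-]].
by apply: (subgroupM sN); [exact: subgroupV|exact: fin_normal].
Qed.

Lemma commutator_normal : normalised C.
Proof.
move=> x y Cx; have -> : x ^ y = x * [~ x, y] by rewrite /commg mulKVg.
by apply: (subgroupM sC) => //; apply: mem_commutator => //;
  exact: commutator_sub_N.
Qed.

Lemma commutator_image_subgroup : is_subgroup D.
Proof.
apply/is_subgroupP; split=> [|_ _ [x Cx <-] [y Cy <-]|_ [x Cx <-]].
- by exists 1; [exact: (subgroup1 sC)|rewrite val1].
- by exists (x * y); [exact: (subgroupM sC)|rewrite valM].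
- by exists x^-1; [exact: (subgroupV sC)|rewrite gmulfV].
Qed.

Lemma commutator_image_norm g h : D g -> gset h -> D (g ^ h).
Proof.
move=> [x Cx <-] /subgroup_lift[y <-]; exists (x ^ y); last by rewrite gmulfJ.
exact: commutator_normal.
Qed.

(* If [x] moves [w], then [h1 = delta w k1^-1] and its conjugate by [x] have
   disjoint supports, so [[h1, x]] acts as [k1] below [w] in a commutator with
   [delta w k2]. *)
Lemma commutator_image_moved (x : GT) w k1 k2 : fin_set N x -> val x w <> w ->
    K k1 -> K k2 ->
  D (delta w [~ k1, k2]).
Proof.
move=> Nx xw Kk1 Kk2.
have /KG/subgroup_lift[h1 h1E] := K_delta_word w (subgroupV sK Kk1).
have /KG/subgroup_lift[h2 h2E] := K_delta_word w Kk2.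
have Nh1x : fin_set N [~ h1, x].
  rewrite -invgR; apply: (subgroupV sN).
  by apply: (subgroupM sN); [exact: subgroupV|exact: fin_normal].
exists [~ [~ h1, x], h2]; first exact: mem_commutator.
rewrite !subgroup_valR h1E h2E deltaR.
set a := delta w k1; set b := delta (val x w) (k1^-1 ^ word_sec (val x) w).
have ab l : commute b (delta w l).
  by apply: delta_commute; rewrite ?tree_size //; apply/eqP.
have -> : [~ delta w k1^-1, val x] = a * b by rewrite commgEl deltaJ deltaV
  invgK.
have aJ : a ^ delta w k2 = delta w (k1 ^ k2) by rewrite /conjg !deltaM deltaV.
rewrite [LHS]commgEl conjMg.
have -> : b ^ delta w k2 = b by apply/conjg_fixP/commgP.
have [aC dC] : b * a = a * b /\ b * (a ^ delta w k2) = a ^ delta w k2 * b.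
  by split; rewrite ?aJ; exact: ab.
by rewrite -aC -dC invgM -mulgA mulKg.
Qed.

(** By [K_comm] the copy of [k] below [w0] is a product of commutators of [K] and their inverses;
    [commutator_image_moved] places each of them below [w]. *)
Lemma commutator_image_branch (x : GT) w k : fin_set N x -> val x w <> w ->
    K k ->
  D (delta (w ++ w0) k).
Proof.
move=> Nx xw /K_comm Kk; rewrite delta_cat.
have sDw : is_subgroup [set h | D (delta w h)].
  have sD := commutator_image_subgroup.
  apply/is_subgroupP; split=> [|f1 f2|f1] /=;
    rewrite ?delta_one ?deltaM ?deltaV.
  - exact: subgroup1.
  - exact: subgroupM.
  - exact: subgroupV.
apply: (generatedS sDw) Kk => _ [k1 Kk1 [k2 Kk2 <-]].
exact: (commutator_image_moved Nx xw Kk1 Kk2).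
Qed.

(** Some [h] in the group generated by [t] maps [u] to [v]. Conjugation by [h] twists the copy by a
    section of [h], which the normality of [K] absorbs. *)
Lemma commutator_image_transitive u v k : size u = size v -> (forall l, K l ->
    D (delta u l)) ->
  K k -> D (delta v k).
Proof.
move=> uv Du Kk; have [[i iu] [j jv]] := (t_trans u, t_trans v).
pose h := (t ^+ i)^-1 * t ^+ j.
have hu : h u = v by rewrite treeM -iu treeK uv jv.
have Gh : gset h by apply: (subgroupM sG); [apply: (subgroupV sG)|];
  exact: subgroupX.
have Gs : gset (word_sec h u) by exact: G_word_section.
rewrite -hu -[k](conjgKV (word_sec h u)) -deltaJ;
  apply: commutator_image_norm => //.
by apply/Du/K_norm => //; exact: subgroupV.
Qed.

(** Level [n + 1] is the first one that [N] moves; it is not level 0, since the root is fixed. Below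
    a moved vertex [w] the copy of [K] at [w ++ w0] lies in [C], and [t] spreads it over the whole
    level [n + (1 + size w0)]. *)
Lemma fixed_level : exists n, (forall x, fin_set N x -> forall u, size u = n ->
    val x u = u) /\
  level_subset (n + (1 + size w0)) `<=` C.
Proof.
have [x Nx [w xw]] := t_power_mem N.
pose P n := `[< exists2 x, fin_set N x & exists2 w,
  size w = n & val x w <> w >].
have exP : exists n, P n by exists (size w); apply/asboolP; exists x => //;
  exists w.
case: (ex_minnP exP) => -[|n] /asboolP[{xw}y Ny [{}w wn yw]] min_n.
  by case: w wn yw => // _ []; rewrite tree_root.
exists n; split=> [z Nz u un|].
  apply: contrapT => zu; have : (n.+1 <= n)%N by apply: min_n; apply/asboolP;
    exists z => //; exists u.
  by rewrite ltnn.
move=> z Lz; have [z' Cz' /val_inj <- //] : D (val z).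
apply: (level_subgroup_generate sK commutator_image_subgroup) Lz => v k vn Kk.
apply: (@commutator_image_transitive (w ++ w0)) => //.
  by rewrite size_cat wn vn addnA addn1.
by move=> l; exact: (commutator_image_branch Ny yw).
Qed.

Lemma normal_p_power : exists n, (lcosets setT (fin_set N) #= `I_(p ^ n))%card.
Proof.
have [n [_ LC]] := fixed_level.
apply: index_p_power => // x; exists (n + (1 + size w0) + e)%N.
apply: commutator_sub_N; apply: LC.
by have := @level_subgroup_expK (n + (1 + size w0)) _ (subgroup_valP x);
  rewrite -subgroup_valX.
Qed.

Let M := level_subgroup (1 + size w0) K.

(** The section of [[g, t]] at [t u] is the inverse of the section of [g] at [t u] times the
    conjugate, by the section of [t] at [u], of the section of [g] at [u]. Membership in [M] thus
    passes from [u] to [t u], and transitivity reaches the whole level. *)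
Lemma commute_section n g : gset g -> (forall u, size u = n -> g u = u) ->
    level_subgroup n M [~ g, t] -> M (word_sec g (nseq n x0)) ->
      level_subgroup n M g.
Proof.
move=> Gg gfix gt Mg.
have sM : is_subgroup M := level_subgroup_subgroup _ sK.
have M_norm a h : M a -> gset h -> M (a ^ h) by exact: level_subgroup_norm.
have step u : size u = n -> M (word_sec g u) -> M (word_sec g (t u)).
  move=> un Mu; have tun : size (t u) = n by rewrite tree_size.
  have [_] := gt _ tun; rewrite commgEl word_sectionM.
  have -> : g^-1 (t u) = t u by rewrite -{1}[t u]gfix // treeK.
  rewrite word_sectionJ ?gfix // -{1}[t u](gfix _ tun) word_sectionV => Mc.
  apply: (subgroupVl sM); rewrite -(mulgK (word_sec g u ^ word_sec t u)
    (word_sec g (t u))^-1).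
  apply: (subgroupM sM) => //; apply/(subgroupV sM)/M_norm => //.
  exact: G_word_section.
move=> u un; split; first exact: gfix.
have [i <-] := t_trans u; rewrite un.
elim: i => [|i IHi]; first by rewrite expg0.
rewrite expgSr treeM; apply: step => //.
by rewrite tree_size size_nseq.
Qed.

(** The level [n] depends on [N], but the bound does not: modulo [S], an element of [N] commuting
    with [t] is determined by its section modulo [M] at one vertex of level [n], and [level_data]
    takes values in a fixed finite set. *)
Lemma commutator_cover : exists S : finite_index_normal GT, S `<=` C /\
  exists s : seq GT, (size s <= #|{: {ffun (1 + size w0).-tuple 'I_p ->
      (1 + size w0).-tuple 'I_p * 'I_nc}}|)%N /\
    forall x, fin_set N x -> exists2 y, y \in s & C (y^-1 * x).
Proof.
have [n [Nfix LC]] := fixed_level.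
exists (level_normal_subgroup (n + (1 + size w0))); split=> //.
have [t' t'E] := subgroup_lift Gt.
apply: (@centraliser_cover _ (level_normal_subgroup (n + (1 + size w0)))
  (fin_set N) t' _
  (fun x => level_data (1 + size w0) (word_sec (val x) (nseq n x0)))) => //.
- exact: commutator_sub_N.
- by move=> x Nx; exact: mem_commutator.
move=> x y Nx Ny; rewrite /= /level_subset /mkset subgroup_valR t'E
  level_subgroup_add => xyt xy.
have Nxy : fin_set N (x^-1 * y) by apply: (subgroupM sN) => //;
  exact: subgroupV.
apply: commute_section => //; first exact: subgroup_valP.
  exact: Nfix.
rewrite valM gmulfV word_sectionM.
have x0E : val x (nseq n x0) = nseq n x0 by apply: Nfix; rewrite ?size_nseq.
rewrite -{1 2}x0E word_sectionV treeK; apply: level_dataP => //.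
- by apply: G_word_section; exact: subgroup_valP.
- by apply: G_word_section; exact: subgroup_valP.
Qed.
End NormalSubgroup.

Theorem criterion_finite_central_width (R : realType) :
  finite_central_width (profinite_completion GT) R p.
Proof.
apply: completion_finite_central_width => // N.
- exact: normal_p_power.
- exact: commutator_cover.
Qed.

Lemma criterion_not_torsion : ~ torsion GT.
Proof.
have [t' t'E] := subgroup_lift Gt.
move=> /(_ t')[n n_gt0 tn]; apply: (t_infinite_order n_gt0).
by rewrite -t'E -subgroup_valX tn val1.
Qed.
End Criterion.

(** * Derived subgroups and finite abelian quotients *)

Section CommutatorTheory.
Variable U : groupType.
Implicit Types (A B H K X Z : set U) (x y g h : U).

Lemma commutator_subgroup_sub A B H : is_subgroup H -> A `<=` H -> B `<=` H ->
  commutator_subgroup A B `<=` H.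
Proof.
move=> sH AH BH; apply: generatedS => // _ [x /AH Hx [y /BH Hy <-]].
exact: subgroupR.
Qed.

Lemma commutator_subgroupJ A B g : (forall x, A x -> A (x ^ g)) ->
    (forall x, B x -> B (x ^ g)) ->
  forall z, commutator_subgroup A B z -> commutator_subgroup A B (z ^ g).
Proof.
move=> Ag Bg.
have sC := commutator_subgroupP A B.
have sP : is_subgroup [set z | commutator_subgroup A B (z ^ g)].
  apply/is_subgroupP; split=> [|x y|x] /=.
  - by rewrite conj1g; exact: subgroup1.
  - by rewrite conjMg; exact: subgroupM.
  - by rewrite conjVg; exact: subgroupV.
apply: (generatedS sP) => _ [x Ax [y By <-]] /=.
by rewrite conjRg; apply: mem_commutator; [exact: Ag|exact: Bg].
Qed.

(** The identities for [[g h, y]] and [[g^-1, y]] extend the inclusion from generators to the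
    generated group, first in one argument and then in the other. *)
Lemma generated_commutator X Z : is_subgroup Z ->
    (forall z g, Z z -> generated X g -> Z (z ^ g)) ->
    (forall x y, X x -> X y -> Z [~ x, y]) ->
  commutator_subgroup (generated X) (generated X) `<=` Z.
Proof.
move=> sZ nZ XZ; set H := generated X.
have sH : is_subgroup H := generated_subgroup X.
have stepM g h y : H h -> Z [~ g, y] -> Z [~ h, y] -> Z [~ g * h, y].
  move=> Hh Zg Zh; have -> : [~ g * h, y] = [~ g, y] ^ h * [~ h, y].
    by rewrite /commg /conjg invgM !mulgA !(mulgK, mulgVK).
  by apply: (subgroupM sZ) => //; exact: nZ.
have stepV g y : H g -> Z [~ g, y] -> Z [~ g^-1, y].
  move=> Hg Zg; have -> : [~ g^-1, y] = ([~ g, y]^-1) ^ g^-1.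
    by rewrite /commg /conjg !invgM !invgK !mulgA !(mulgK, mulgVK).
  by apply: nZ; [exact: (subgroupV sZ)|exact: (subgroupV sH)].
have XH x y : X x -> H y -> Z [~ y, x].
  move=> Xx; have sP : is_subgroup [set y | H y /\ Z [~ y, x]].
    apply/is_subgroupP; split=> [|g h [Hg Zg] [Hh Zh]|g [Hg Zg]].
    - by split; [exact: (subgroup1 sH)|rewrite comm1g; exact: (subgroup1 sZ)].
    - by split; [exact: (subgroupM sH)|exact: stepM].
    - by split; [exact: (subgroupV sH)|exact: stepV].
  move=> Hy; have [] // : [set y | H y /\ Z [~ y, x]] y.
  apply: (generatedS sP) Hy => z Xz; split; first exact: mem_generated.
  exact: XZ.
have HH x y : H x -> H y -> Z [~ y, x].
  move=> Hx; have sP : is_subgroup [set y | H y /\ Z [~ y, x]].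
    apply/is_subgroupP; split=> [|g h [Hg Zg] [Hh Zh]|g [Hg Zg]].
    - by split; [exact: (subgroup1 sH)|rewrite comm1g; exact: (subgroup1 sZ)].
    - by split; [exact: (subgroupM sH)|exact: stepM].
    - by split; [exact: (subgroupV sH)|exact: stepV].
  move=> Hy; have [] // : [set y | H y /\ Z [~ y, x]] y.
  apply: (generatedS sP) Hy => z Xz; split; first exact: mem_generated.
  by rewrite -invgR; apply: (subgroupV sZ); exact: XH.
by apply: generatedS => // _ [x Hx [y Hy <-]]; exact: HH.
Qed.

Section AbelianQuotient.
Variables H K : set U.
Hypotheses (sH : is_subgroup H) (sK : is_subgroup K).
Hypothesis K_norm : forall k g, K k -> H g -> K (k ^ g).
Hypothesis HK : forall g h, H g -> H h -> K [~ g, h].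

Lemma expgM_mod g h n : H g -> H h ->
  exists2 k, K k & (g * h) ^+ n = g ^+ n * h ^+ n * k.
Proof.
move=> Hg Hh; elim: n => [|n [k Kk IHn]].
  by exists 1; rewrite ?expg0 ?mulg1 //; exact: subgroup1.
exists ([~ h, g ^+ n] ^ (h ^+ n) * k).
  apply: (subgroupM sK) => //; apply: K_norm; last exact: subgroupX.
  by apply: HK => //; exact: subgroupX.
have hg : h * g ^+ n = g ^+ n * h * [~ h, g ^+ n] by rewrite -commgC.
rewrite !expgS IHn /conjg !mulgA -[g * h * g ^+ n]mulgA hg !mulgA.
by rewrite !(mulgK, mulgVK).
Qed.

(** Elements of [A] move past powers of [x] at the cost of a commutator in [K], and the inverse of a
    power of [x] is again a power by finite order. *)
Lemma adjoin_subgroup A x m : is_subgroup A -> K `<=` A -> A `<=` H -> H x ->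
  (0 < m)%N -> x ^+ m = 1 -> is_subgroup [set g | exists2 i, True & exists2 y,
    A y & g = x ^+ i * y].
Proof.
move=> sA KA AH Hx m_gt0 xm; have xV i : (x ^+ i)^-1 = x ^+ (i * m.-1).
  by apply: mulg1_eq; rewrite -expgnDr -mulnS prednK // mulnC expgnA xm expg1n.
have swap y i : A y -> exists2 z, A z & y * x ^+ i = x ^+ i * z.
  move=> Ay; exists (y * [~ y, x ^+ i]); last by rewrite mulgA -commgC.
  apply: (subgroupM sA) => //; apply/KA/HK; [exact: AH|exact: subgroupX].
apply/is_subgroupP; split=> [|_ _ [i _ [y Ay ->]] [j _ [z Az ->]]|_ [i _ [y Ay
  ->]]].
- by exists 0%N => //; exists 1; rewrite ?mulg1 //; exact: subgroup1.
- have [y' Ay' yE] := swap y j Ay; exists (i + j)%N => //; exists (y' * z).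
    exact: subgroupM.
  by rewrite expgnDr -!mulgA [y * _]mulgA yE !mulgA.
- have [z Az zE] := swap _ (i * m.-1)%N (subgroupV sA Ay).
  by exists (i * m.-1)%N => //; exists z; rewrite // invgM xV.
Qed.

(** The elements of [s] are adjoined to [K] one at a time. The new colour of [x ^ i * y] is the pair
    of [i], reduced modulo [m], and the old colour of [y]. *)
Lemma finite_abelian_quotient (s : seq U) m : K `<=` H -> (0 < m)%N ->
    (forall x, x \in s -> H x /\ x ^+ m = 1) ->
  exists A, [/\ is_subgroup A, K `<=` A, A `<=` H, (forall x, x \in s -> A x) &
    exists n (c : U -> 'I_n), forall g h, A g -> A h -> c g = c h ->
      K (g^-1 * h)].
Proof.
move=> KH m_gt0; elim: s => [|x s IHs] sH'.
  exists K; split=> //; exists 1%N, (fun=> ord0) => g h Kg Kh _.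
  by apply: (subgroupM sK) => //; exact: subgroupV.
have [] := IHs (fun y ys => sH' y (mem_behead (s := x :: s) ys)).
move=> A [sA KA AH As [n [c cK]]]; have [Hx xm] := sH' x (mem_head _ _).
pose B := [set g | exists2 i, True & exists2 y, A y & g = x ^+ i * y].
have AB y : A y -> B y by move=> Ay; exists 0%N => //; exists y; rewrite ?mul1g.
exists B; split.
- exact: (adjoin_subgroup sA KA AH Hx m_gt0 xm).
- by move=> k /KA; exact: AB.
- move=> _ [i _ [y Ay ->]]; apply: (subgroupM sH); first exact: subgroupX.
  exact: AH.
- move=> y; rewrite in_cons => /predU1P[->|/As]; last exact: AB.
  by exists 1%N => //; exists 1; rewrite ?mulg1 //; exact: subgroup1.
have decP g : exists iy : 'I_m * U, B g -> A iy.2 /\ g = x ^+ iy.1 * iy.2.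
  have [[i _ [y Ay ->]]|nB] := pselect (B g); last first.
    by exists (Ordinal m_gt0, 1).
  exists (Ordinal (ltn_pmod i m_gt0), y) => _; split=> //=.
  by rewrite {1}(divn_eq i m) expgnDr mulnC expgnA xm expg1n mul1g.
have [dec {}decP] := choice decP.
exists #|{: 'I_m * 'I_n}|, (fun g => enum_rank ((dec g).1, c (dec g).2)) =>
  g h Bg Bh.
have [[Ag gE] [Ah hE]] := (decP g Bg, decP h Bh).
move=> /enum_rank_inj[i_eq c_eq].
by rewrite gE hE i_eq invgM -!mulgA mulKg; exact: cK.
Qed.
End AbelianQuotient.
End CommutatorTheory.

(** * The groups generated by [a] and [b_0, ..., b_(r-1)] *)

Section Family.
Variable p : nat.
Hypothesis p_pr : prime p.
Hypothesis p_ge3 : (3 <= p)%N.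
Local Notation T := (tree_aut p).
Implicit Types (f g h k : T) (x y : 'I_p) (u v w : seq 'I_p) (i j s : nat).

Lemma p_gt0 : (0 < p)%N. Proof. exact: prime_gt0. Qed.

Definition vertex0 : 'I_p := Ordinal p_gt0.

Local Notation a := (@rooted_a p).

(** The leading [None] puts the automorphism itself at vertex 0; entry [m] of the remaining list
    belongs to vertex [m + 1]. *)
Definition directed_b i : T := directed (None :: [seq Some (a ^+ (m == i)) | m
    <- iota 0 p.-1]).

Lemma root_perm_a x : root_perm a x = ordS x. Proof. by []. Qed.

Lemma section_a x : sec a x = 1.
Proof. by apply: (section_unique (y := ordS x) _).2. Qed.

Lemma section_aX s x : sec (a ^+ s) x = 1.
Proof.
elim: s x => [|s IHs] x; first by rewrite expg0 section1.
by rewrite expgS sectionM section_a IHs mulg1.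
Qed.

Lemma root_perm_aX s x : root_perm (a ^+ s) x = (x + s) %% p :> nat.
Proof.
elim: s => [|s IHs]; first by rewrite expg0 root_perm1 addn0 modn_small.
by rewrite expgSr root_permM root_perm_a /= IHs -[(_ %% _).+1]addn1 modnDml
  addn1 addnS.
Qed.

Lemma aXp : a ^+ p = 1.
Proof.
apply: tree_ext => x; last by rewrite section_aX section1.
by apply: val_inj; rewrite /= root_perm_aX modnDr modn_small.
Qed.

Lemma directed_b_cons i x v : directed_b i (x :: v) =
  x :: (if x == 0%N :> nat then directed_b i else a ^+ (x == i.+1 :> nat)) v.
Proof.
rewrite /directed_b directedE; case: x => -[|m] mp //=.
by rewrite (nth_map 0%N) ?size_iota ?nth_iota ?add0n //; case: p mp.
Qed.

Lemma root_perm_b i x : root_perm (directed_b i) x = x.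
Proof. exact: (section_unique (directed_b_cons i x)).1. Qed.

Lemma section_b i x : sec (directed_b i) x =
  if x == 0%N :> nat then directed_b i else a ^+ (x == i.+1 :> nat).
Proof. exact: (section_unique (directed_b_cons i x)).2. Qed.

Lemma section_b0 i : sec (directed_b i) vertex0 = directed_b i.
Proof. by rewrite section_b. Qed.

Lemma section_fixX g x n : root_perm g x = x -> root_perm (g ^+ n) x = x /\
    sec (g ^+ n) x = sec g x ^+ n.
Proof.
move=> gx; elim: n => [|n [IHt IHs]]; first by rewrite !expg0 section1.
by rewrite !expgS root_permM sectionM gx IHt IHs.
Qed.

(** Induction along a word: the section at vertex 0 is the element itself, and the others are powers
    of [a]. *)
Lemma bXp i : directed_b i ^+ p = 1.
Proof.
apply: tree_autP; elim=> [|x v IHv]; first by rewrite tree_root.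
have [topE secE] := section_fixX p (root_perm_b i x).
rewrite treeE topE secE section_b; case: ifP => _; first by rewrite IHv.
by case: eqP; rewrite ?expg1n // expg1 aXp.
Qed.

Lemma b_commute i j : commute (directed_b i) (directed_b j).
Proof.
apply: tree_autP; elim=> [|x v IHv]; first by rewrite !tree_root.
rewrite !treeE !root_permM !root_perm_b !sectionM !root_perm_b !section_b;
  case: ifP => _; first by rewrite IHv.
by congr (_ :: _); congr (tree_fun _ _); apply: commuteX2.
Qed.

Definition conj_b i s : T := directed_b i ^ (a ^+ s)^-1.

Lemma section_conj_fix f g x : root_perm f (root_perm g x) = root_perm g x -> 
  root_perm (f ^ g^-1) x = x /\ sec (f ^ g^-1) x = sec f (root_perm g x) ^ (sec
    g x)^-1.
Proof.
move=> fgx; rewrite /conjg invgK !root_permM !sectionM fgx; split;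
  first exact: root_permK.
by rewrite sectionV invgK.
Qed.

Lemma root_perm_conj_b i s x : root_perm (conj_b i s) x = x.
Proof. by have [] := @section_conj_fix (directed_b i) (a ^+ s) x (root_perm_b _
  _). Qed.

Lemma section_conj_b i s x : sec (conj_b i s) x = sec (directed_b i) (root_perm
    (a ^+ s) x).
Proof.
have [_ ->] := @section_conj_fix (directed_b i) (a ^+ s) x (root_perm_b _ _).
by rewrite section_aX invg1 conjg1.
Qed.

Lemma section_commutator_fix f g x : root_perm f x = x -> root_perm g x = x ->
  root_perm [~ f, g] x = x /\ sec [~ f, g] x = [~ sec f x, sec g x].
Proof.
move=> fx gx; have [fVx gVx] : root_perm f^-1 x = x /\ root_perm g^-1 x = x.
  by split; [rewrite -{1}fx root_permK|rewrite -{1}gx root_permK].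
have [sf sg] : sec f^-1 x = (sec f x)^-1 /\ sec g^-1 x = (sec g x)^-1.
  by split; [rewrite -{1}fx|rewrite -{1}gx]; exact: sectionV.
by rewrite /commg /conjg !root_permM !sectionM !(fVx, gVx, fx, gx) sf sg.
Qed.

Lemma double_neq i : (i.+1 < p)%N ->
  ((i.+1 + i.+1) %% p != 0)%N /\ ((i.+1 + i.+1) %% p != i.+1)%N.
Proof.
move=> ip; split.
  (* The prime [p] divides neither factor, both being positive and smaller than [p]. *)
  have : ~~ (p %| i.+1 * 2)%N by rewrite Euclid_dvdM // negb_or !gtnNdvd.
  by rewrite muln2 -addnn.
apply/negP => /eqP E; have : i.+1 + i.+1 == i.+1 + 0 %[mod p].
  by rewrite addn0 E modn_small.
by rewrite eqn_modDl mod0n modn_small.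
Qed.

(** Outside vertex 0 the only nontrivial section of [b_i] is at [i + 1], where the conjugate shows
    the section of [b_i] at [2 (i + 1)], which is trivial. At vertex 0 the conjugate shows [a]. *)
Lemma commutator_delta i : (i.+1 < p)%N ->
  [~ directed_b i, conj_b i i.+1] = delta1 vertex0 [~ directed_b i, a].
Proof.
move=> ip; have [n0 ni] := double_neq ip.
apply: tree_ext => x.
  by have [-> _] := section_commutator_fix (root_perm_b i x) (root_perm_conj_b
    i i.+1 x).
have [_ ->] := section_commutator_fix (root_perm_b i x) (root_perm_conj_b i
  i.+1 x).
rewrite section_delta1 section_conj_b !section_b root_perm_aX.
rewrite (_ : (x == vertex0) = (x == 0%N :> nat)) //.
have [->|x0] := eqVneq (x : nat) 0%N;
  first by rewrite add0n modn_small //= eqxx.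
have [->|xi] := eqVneq (x : nat) i.+1; last by rewrite expg0 comm1g.
by rewrite (negPf n0) (negPf ni) expg0 commg1.
Qed.

Section Group.
Variable r : nat.
Hypothesis r_gt0 : (0 < r)%N.
Hypothesis r_lt : (r < p)%N.

Definition fam_gens : set T := [set a] `|` [set directed_b i | i in [set i | (i
    < r)%N]].
Definition famG : subgroup T := generated_group fam_gens.
Local Notation G := (generated fam_gens).
Let sG : is_subgroup G. Proof. exact: generated_subgroup. Qed.

Lemma a_mem : G a. Proof. by apply: mem_generated; left. Qed.

Lemma b_mem i : (i < r)%N -> G (directed_b i).
Proof. by move=> ir; apply: mem_generated; right; exists i. Qed.

Lemma aX_mem s : G (a ^+ s). Proof. exact: (subgroupX _ sG a_mem). Qed.

Lemma famG_section g x : G g -> G (sec g x).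
Proof.
suff /[apply]-[_] : G `<=` [set g | G g /\ forall x, G (sec g x)] by exact.
apply: generatedS => [|f].
  apply/is_subgroupP; split=> [|f1 f2 [G1 s1] [G2 s2]|f1 [G1 s1]].
  - by split=> [|y]; rewrite ?section1; exact: (subgroup1 sG).
  - by split=> [|y]; rewrite ?sectionM; apply: (subgroupM sG).
  - by split=> [|y]; rewrite -1?(root_permVK f1 y) ?sectionV;
    apply: (subgroupV sG).
case=> [->|[i ir <-]].
  by split=> [|y]; rewrite ?section_a; [exact: a_mem|exact: (subgroup1 sG)].
split=> [|y]; first exact: b_mem.
by rewrite section_b; case: ifP => _; [exact: b_mem|exact: aX_mem].
Qed.

(** The directed generators fix the first level, so only the cyclic action of [a] remains. *)
Lemma famG_root_perm g : G g -> exists s, root_perm g =1 root_perm (a ^+ s).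
Proof.
suff /[apply] : G `<=` [set g | exists s,
  root_perm g =1 root_perm (a ^+ s)] by [].
apply: generatedS => [|f].
  apply/is_subgroupP; split=> [|f1 f2 [s1 E1] [s2 E2]|f1 [s1 E1]].
  - by exists 0%N.
  - by exists (s1 + s2)%N => y; rewrite expgnDr !root_permM E1 E2.
  - exists (s1 * p.-1)%N => y.
    have <- : (a ^+ s1)^-1 = a ^+ (s1 * p.-1).
      by apply: mulg1_eq; rewrite -expgnDr -mulnS prednK ?p_gt0 // mulnC expgnA
        aXp expg1n.
    by rewrite -{2}(root_permVK f1 y) E1 root_permK.
case=> [->|[i ir <-]]; first by exists 1%N.
by exists 0%N => y; rewrite root_perm_b.
Qed.

Lemma famG_root_permX g x : G g -> root_perm (g ^+ p) x = x.
Proof.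
move=> /famG_root_perm[s gs]; have topX n y : root_perm (g ^+ n) y = root_perm
  ((a ^+ s) ^+ n) y.
  by elim: n y => [|n IHn] y; rewrite ?expg0 // !expgS !root_permM gs IHn.
by rewrite topX -expgnA mulnC expgnA aXp expg1n.
Qed.

(** * Branching over the derived subgroup [K], with [K3] the third term of the lower central
    series *)

Local Notation K := (commutator_subgroup G G).
Local Notation K3 := (commutator_subgroup K G).

Let sK : is_subgroup K. Proof. exact: commutator_subgroupP. Qed.
Let sK3 : is_subgroup K3. Proof. exact: commutator_subgroupP. Qed.

Lemma derived_sub : K `<=` G. Proof. by apply: (commutator_subgroup_sub sG).
    Qed.

Lemma derived_norm k g : K k -> G g -> K (k ^ g).
Proof. by move=> Kk Gg; apply: commutator_subgroupJ Kk => x Gx;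
  exact: (subgroupJ sG). Qed.

Lemma gamma3_norm k g : K3 k -> G g -> K3 (k ^ g).
Proof.
move=> Kk Gg; apply: commutator_subgroupJ Kk => x; first by move=> Kx;
  exact: derived_norm.
by move=> Gx; exact: (subgroupJ sG).
Qed.

Lemma gamma3_derived : K3 `<=` K.
Proof.
apply: (generatedS sK) => _ [k Kk [g Gg <-]].
by apply: (subgroupM sK); [exact: (subgroupV sK)|exact: derived_norm].
Qed.

Lemma conj_b_mod i s : (i < r)%N -> K ((directed_b i)^-1 * conj_b i s).
Proof.
move=> ir; apply: mem_commutator; first exact: b_mem.
by apply: (subgroupV sG); exact: aX_mem.
Qed.

Lemma conj_b_div i s s' : (i < r)%N -> K ((conj_b i s)^-1 * conj_b i s').
Proof.
move=> ir; have := subgroupM sK (subgroupV sK (conj_b_mod s ir)) (conj_b_mod s'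
  ir).
by rewrite invgM invgK -mulgA mulKVg.
Qed.

(** This allows conjugation by any element of [G] below vertex 0 to be carried out by an element of
    [K]. *)
Lemma section_lift g : G g -> exists h, [/\ K h,
    root_perm h vertex0 = vertex0 & sec h vertex0 = g].
Proof.
suff /[apply] : G `<=` [set g | exists h, [/\ K h,
  root_perm h vertex0 = vertex0 & sec h vertex0 = g]] by [].
apply: generatedS => [|f].
  apply/is_subgroupP; split=> [|f1 f2 [h1 [K1 t1 s1]] [h2 [K2 t2 s2]]|f1 [h1
    [K1 t1 s1]]].
  - by exists 1; rewrite section1; split=> //; exact: (subgroup1 sK).
  - by exists (h1 * h2); rewrite root_permM sectionM t1 t2 s1 s2; split=> //;
    exact: (subgroupM sK).
  - exists h1^-1; split; first exact: (subgroupV sK).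
      by rewrite -{1}t1 root_permK.
    by rewrite -{1}t1 sectionV s1.
have lift i s : (i < r)%N ->
    exists h, [/\ K h, root_perm h vertex0 = vertex0 & sec h vertex0 = sec
      (conj_b i s) vertex0].
  move=> ir; have ip : (i.+1 < p)%N by exact: leq_ltn_trans ir r_lt.
  have [n0 ni] := double_neq ip.
  (* The conjugate with shift [2 (i + 1)] has trivial section at vertex 0; dividing by it moves
     [conj_b i s] into [K] and keeps the section there. *)
  exists ((conj_b i (i.+1 + i.+1))^-1 * conj_b i s); split;
    first exact: conj_b_div.
    by rewrite root_permM -{1}(root_perm_conj_b i (i.+1 + i.+1) vertex0)
      root_permK root_perm_conj_b.
  rewrite sectionM -{1 2}(root_perm_conj_b i (i.+1 + i.+1) vertex0) sectionV
    root_permK.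
  rewrite section_conj_b section_b root_perm_aX add0n (negPf n0) (negPf ni)
    expg0.
  by rewrite invg1 mul1g.
case=> [->|[i ir <-]].
  (* Shift 1 brings the section [a] of [b_0] from vertex 1 to vertex 0. *)
  have [h [Kh th sh]] := lift 0%N 1%N r_gt0; exists h; split=> //.
  by rewrite sh section_conj_b section_b root_perm_aX add0n modn_small //;
    exact: ltn_trans p_ge3.
have [h [Kh th sh]] := lift i 0%N ir; exists h; split=> //.
by rewrite sh section_conj_b expg0 section_b0.
Qed.

(** By [section_lift] the elements whose copy lies in [Z] form a set normalised by [G], so
    commutators of generators suffice; as the [b_i] commute, only [[b_i, a]] and its inverse
    matter. *)
Lemma delta_derived_sub (Z : set T) : is_subgroup Z -> (forall z g, Z z ->
    G g -> Z (z ^ g)) ->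
    (forall i, (i < r)%N -> Z (delta1 vertex0 [~ directed_b i, a])) ->
  forall k, K k -> Z (delta1 vertex0 k).
Proof.
move=> sZ Z_norm Zba.
have sP : is_subgroup [set k | Z (delta1 vertex0 k)].
  apply/is_subgroupP; split=> [|k1 k2|k1] /=.
  - by rewrite delta1_one; exact: (subgroup1 sZ).
  - by rewrite delta1M; exact: (subgroupM sZ).
  - by rewrite delta1V; exact: (subgroupV sZ).
apply: generated_commutator => // [z g Zz /section_lift[h [Kh th sh]] | f g].
  rewrite /mkset -sh -{1}th -delta1J; apply: Z_norm => //; exact: derived_sub.
rewrite /mkset; case=> [->|[i ir <-]]; case=> [->|[j jr <-]].
- by rewrite commgg delta1_one; exact: (subgroup1 sZ).
- by rewrite -invgR delta1V; apply: (subgroupV sZ); exact: Zba.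
- exact: Zba.
- have /commgP/eqP -> := b_commute i j.
  by rewrite delta1_one; exact: (subgroup1 sZ).
Qed.

(** Since [c_(i+1) = b_i k1] with [k1] in [K], the commutator [[b_i, c_(i+1)] = [b_i, k1]] lies in
    [K3], and it is the copy of [[b_i, a]]. *)
Lemma delta_derived_gamma3 k : K k -> K3 (delta1 vertex0 k).
Proof.
apply: (delta_derived_sub sK3 gamma3_norm) => i ir.
have ip : (i.+1 < p)%N by exact: leq_ltn_trans ir r_lt.
rewrite -commutator_delta // -[conj_b i i.+1](mulKVg (directed_b i)).
set k1 := _^-1 * conj_b _ _.
have -> : [~ directed_b i, directed_b i * k1] = [~ k1, directed_b i]^-1.
  by rewrite invgR /commg /conjg !invgM !mulgA !(mulgK, mulgVK).
by apply: (subgroupV sK3); apply: mem_commutator;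
  [exact: conj_b_mod|exact: b_mem].
Qed.

Lemma delta1_derived x k : K k -> K (delta1 x k).
Proof.
move=> Kk; have tx : root_perm (a ^+ x) vertex0 = x.
  by apply: val_inj; rewrite /= root_perm_aX add0n modn_small.
have := derived_norm (gamma3_derived (delta_derived_gamma3 Kk)) (aX_mem x).
by rewrite delta1J tx section_aX conjg1.
Qed.

(** If [h] in [K] fixes vertex 0 with section [g], the copy of [[k, g]] is the commutator of the
    copy of [k] with [h]. *)
Lemma delta_gamma3_commutator z : K3 z ->
    commutator_subgroup K K (delta1 vertex0 z).
Proof.
have sKK := commutator_subgroupP K K.
have sP : is_subgroup [set k | commutator_subgroup K K (delta1 vertex0 k)].
  apply/is_subgroupP; split=> [|k1 k2|k1] /=.
  - by rewrite delta1_one; exact: (subgroup1 sKK).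
  - by rewrite delta1M; exact: (subgroupM sKK).
  - by rewrite delta1V; exact: (subgroupV sKK).
apply: (generatedS sP) => _ [k Kk [g /section_lift[h [Kh th sh]] <-]] /=.
have -> : delta1 vertex0 [~ k, g] = [~ delta1 vertex0 k, h].
  by rewrite !commgEl delta1M delta1V delta1J th sh.
by apply: mem_commutator => //; exact: delta1_derived.
Qed.

Lemma delta_derived_commutator k : K k ->
    commutator_subgroup K K (delta [:: vertex0; vertex0] k).
Proof. by move=> Kk; apply: delta_gamma3_commutator;
  exact: delta_derived_gamma3. Qed.

Lemma famG_expp g : G g -> K (g ^+ p).
Proof.
have GK f h : G f -> G h -> K [~ f, h] by exact: mem_commutator.
suff /[apply]-[] : G `<=` [set g | G g /\ K (g ^+ p)] by [].
apply: generatedS => [|f].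
  apply/is_subgroupP; split=> [|f1 f2 [G1 K1] [G2 K2]|f1 [G1 K1]].
  - by rewrite /mkset expg1n; split;
    [exact: (subgroup1 sG)|exact: (subgroup1 sK)].
  - split; first exact: (subgroupM sG).
    have [k Kk ->] := expgM_mod sG sK derived_norm GK p G1 G2.
    by apply: (subgroupM sK) => //; exact: (subgroupM sK).
  - rewrite /mkset expVgn; split; first exact: (subgroupV sG).
    exact: (subgroupV sK).
case=> [->|[i ir <-]].
  by rewrite /mkset aXp; split; [exact: a_mem|exact: (subgroup1 sK)].
by rewrite /mkset bXp; split; [exact: b_mem|exact: (subgroup1 sK)].
Qed.

Lemma famG_quotient : exists n (c : T -> 'I_n),
  forall g h, G g -> G h -> c g = c h -> K (g^-1 * h).
Proof.
have GK f h : G f -> G h -> K [~ f, h] by exact: mem_commutator.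
have [|A [sA KA AG As [n [c cK]]]] :=
    finite_abelian_quotient sG sK GK (s :=
      a :: [seq directed_b i | i <- iota 0 r]) derived_sub p_gt0.
  move=> f; rewrite in_cons => /predU1P[->|/mapP[i]]; first by rewrite aXp;
    split=> //; exact: a_mem.
  by rewrite mem_iota add0n => ir ->; rewrite bXp; split=> //; exact: b_mem.
have GA : G `<=` A.
  apply: generatedS => // f [->|[i ir <-]]; apply: As; first exact: mem_head.
  by rewrite in_cons map_f ?orbT // mem_iota.
by exists n, c => g h /GA Ag /GA Ah; exact: cK.
Qed.

(** * An element transitive on every level *)

Definition cyc : T := a * directed_b 0.

Lemma cyc_mem : G cyc.
Proof. by apply: (subgroupM sG); [exact: a_mem|exact: b_mem]. Qed.

Lemma root_perm_cycX s x : root_perm (cyc ^+ s) x = root_perm (a ^+ s) x.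
Proof.
by elim: s x => [|s IHs] x; rewrite ?expg0 // !expgS !root_permM root_perm_b
  IHs.
Qed.

(** The orbit of vertex 0 picks up the section [a] of [b_0] at vertex 1, then trivial sections until
    it returns to 0. *)
Lemma section_cycX s : (s.+1 < p)%N -> sec (cyc ^+ s.+1) vertex0 = a.
Proof.
have secE x : sec cyc x = sec (directed_b 0) (ordS x) by rewrite sectionM
  section_a mul1g.
elim: s => [|s IHs] sp.
  by rewrite expg1 secE section_b /= modn_small // (ltn_trans _ p_ge3).
rewrite expgSr sectionM IHs 1?ltnW // secE section_b /= root_perm_cycX
  root_perm_aX.
by rewrite add0n -addn1 modnDml addn1 modn_small //= expg0 mulg1.
Qed.

(** The last step returns to vertex 0 and contributes [b_0], which gives [a b_0]. *)
Lemma cyc_expp : root_perm (cyc ^+ p) vertex0 = vertex0 /\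
    sec (cyc ^+ p) vertex0 = cyc.
Proof.
split; first by rewrite root_perm_cycX aXp.
have [q pq] : exists q, p = q.+2 by exists p.-2; case: p p_ge3 => [|[]].
have -> : cyc ^+ p = cyc ^+ q.+1 * cyc by rewrite -expgSr; congr (_ ^+ _).
have qp : (q.+1 < p)%N by rewrite pq.
have q0 : ((q.+1 %% p).+1 %% p)%N = 0%N by rewrite -addn1 modnDml addn1 -pq
  modnn.
by rewrite sectionM section_cycX // sectionM section_a mul1g section_b /=
  root_perm_cycX root_perm_aX q0.
Qed.

Lemma cyc_transitive u : exists i, (cyc ^+ i) (nseq (size u) vertex0) = u.
Proof.
suff trans_level n : forall w, size w = n -> exists i,
  (cyc ^+ i) (nseq n vertex0) = w.
  exact: trans_level.
elim: n => [|n IHn] [|x v] //=; first by exists 0%N; rewrite tree_root.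
move=> [vn].
(* The first [p * j] steps act below vertex 0 as [cyc ^+ j]; the next [x] steps lead to vertex [x]
   and apply [h]. *)
set h := sec (cyc ^+ x) vertex0.
have [|j jE] := IHn (h^-1 v); first by rewrite tree_size.
exists (p * j + x)%N; rewrite expgnDr expgnA treeM /=.
have [tp sp] := cyc_expp; have [tpj spj] := section_fixX j tp.
rewrite treeE tpj spj sp jE treeE treeVK; congr (_ :: _); apply: val_inj.
by rewrite /= root_perm_cycX root_perm_aX add0n modn_small.
Qed.

Lemma famG_finite_central_width (R : realType) :
  finite_central_width (profinite_completion (subgroup_type famG)) R p.
Proof.
have [n [c cK]] := famG_quotient.
apply: (@criterion_finite_central_width p famG K cyc vertex0 [:: vertex0;
  vertex0] 1 n c p_pr) => //.
- exact: famG_section.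
- exact: famG_root_permX.
- exact: derived_sub.
- exact: derived_norm.
- exact: delta1_derived.
- exact: delta_derived_commutator.
- by move=> g Gg; rewrite expn1; exact: famG_expp.
- exact: cyc_mem.
- exact: cyc_transitive.
Qed.

Lemma famG_not_torsion : ~ torsion (subgroup_type famG).
Proof. exact: (@criterion_not_torsion p famG cyc vertex0 p_pr cyc_mem
  cyc_transitive). Qed.
End Group.
End Family.

(** * Homomorphisms to the field of [p] elements *)

Section Homomorphisms.
Variable p : nat.
Hypothesis p_pr : prime p.
Local Notation T := (tree_aut p).
Local Notation a := (@rooted_a p).
Local Notation vertex0 := (vertex0 p_pr).
Implicit Types (f g h k : T) (x : 'I_p) (i j s n : nat).
Local Open Scope ring_scope.

(** On [G] the first-level action is that of a power of [a], whose exponent is the image of vertex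
    0. *)
Definition label g : 'F_p := (root_perm g vertex0)%:R.

Lemma labelE g s : root_perm g =1 root_perm (a ^+ s)%g -> label g = s%:R.
Proof. by move=> gs; rewrite /label gs root_perm_aX add0n Fp_nat_mod. Qed.

Lemma label1 : label 1%g = 0. Proof. exact: (@labelE _ 0). Qed.

Lemma label_aX s : label (a ^+ s)%g = s%:R. Proof. exact: labelE. Qed.

Lemma labelM r g h : generated (@fam_gens p r) g ->
    generated (@fam_gens p r) h ->
  label (g * h)%g = label g + label h.
Proof.
move=> /(famG_root_perm p_pr)[s gs] /(famG_root_perm p_pr)[s' hs].
rewrite (labelE gs) (labelE hs) -natrD; apply: labelE => x.
by rewrite expgnDr !root_permM gs hs.
Qed.

(* The nucleus: sections of an element of a multi-EGS group at a sufficiently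
   deep level are powers of [a] or directed elements. *)
Definition rooted_part : set T := [set g | exists s, g = (a ^+ s)%g].
Definition directed_part : set T := [set g | [/\ forall x, root_perm g x = x,
  sec g vertex0 = g & forall x, x != vertex0 -> rooted_part (sec g x)]].
Definition nucleus : set T := rooted_part `|` directed_part.

Lemma rooted_partM g h : rooted_part g -> rooted_part h ->
    rooted_part (g * h)%g.
Proof. by move=> [s ->] [s' ->]; exists (s + s')%N; rewrite expgnDr. Qed.

Lemma rooted_partV g : rooted_part g -> rooted_part g^-1%g.
Proof.
move=> [s ->]; exists (s * p.-1)%N; apply: mulg1_eq.
by rewrite -expgnDr -mulnS prednK ?prime_gt0 // mulnC expgnA aXp expg1n.
Qed.

Lemma directed_partM g h : directed_part g -> directed_part h ->
    directed_part (g * h)%g.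
Proof.
move=> [gt go gx] [ht ho hx]; split=> [x||x xo];
  first by rewrite root_permM gt ht.
- by rewrite sectionM gt go ho.
- by rewrite sectionM gt; apply: rooted_partM; [exact: gx|exact: hx].
Qed.

Lemma directed_partV g : directed_part g -> directed_part g^-1%g.
Proof.
move=> [gt go gx]; have gV x : sec g^-1%g x = (sec g x)^-1%g by rewrite -{1}(gt
  x) sectionV.
split=> [x||x xo]; first by rewrite -{1}(gt x) root_permK.
- by rewrite gV go.
- by rewrite gV; apply: rooted_partV; exact: gx.
Qed.

Lemma nucleusV g : nucleus g -> nucleus g^-1%g.
Proof. by move=> [/rooted_partV|/directed_partV]; [left|right]. Qed.

Lemma rooted_part_section g x : rooted_part g -> sec g x = 1%g.
Proof. by move=> [s ->]; rewrite section_aX. Qed.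

Lemma nucleus_section g x : nucleus g -> nucleus (sec g x).
Proof.
move=> [gr|gd]; first by left; exists 0%N; rewrite rooted_part_section.
have [_ go gx] := gd; have [->|xo] := eqVneq x vertex0; first by right;
  rewrite go.
by left; exact: gx.
Qed.

(** Contraction: a rooted factor has trivial sections, and two directed factors have a directed
    product. *)
Lemma nucleusM_section g h x : nucleus g -> nucleus h ->
    nucleus (sec (g * h)%g x).
Proof.
move=> ng nh; case: (ng) => [gr|gd].
  by rewrite sectionM rooted_part_section // mul1g; exact: nucleus_section.
case: (nh) => [hr|hd].
  by rewrite sectionM [sec h _]rooted_part_section // mulg1;
    exact: nucleus_section.
by apply: nucleus_section; right; exact: directed_partM.
Qed.

Fixpoint nucleus_at n g : Prop :=
  if n is m.+1 then forall x, nucleus_at m (sec g x) else nucleus g.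

Lemma nucleus_atS n g : nucleus_at n g -> nucleus_at n.+1 g.
Proof.
elim: n g => [|n IHn] g gn x; first exact: nucleus_section.
by apply: IHn; exact: gn.
Qed.

Lemma nucleus_at_leq m n g : (m <= n)%N -> nucleus_at m g -> nucleus_at n g.
Proof.
move=> /subnK <-; elim: (n - m)%N => [|d IHd] // gm.
by rewrite addSn; apply: nucleus_atS; exact: IHd.
Qed.

Lemma nucleus_atM n g h : nucleus_at n g -> nucleus_at n h ->
    nucleus_at n.+1 (g * h)%g.
Proof.
elim: n g h => [|n IHn] g h gn hn x; first exact: nucleusM_section.
by rewrite sectionM; apply: IHn; [exact: gn|exact: hn].
Qed.

Lemma nucleus_atV n g : nucleus_at n g -> nucleus_at n g^-1%g.
Proof.
elim: n g => [|n IHn] g gn; first exact: nucleusV.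
by move=> x; rewrite -(root_permVK g x) sectionV; apply: IHn; exact: gn.
Qed.

Lemma a_nucleus s : nucleus (a ^+ s)%g. Proof. by left; exists s. Qed.

Lemma b_nucleus i : nucleus (directed_b p i).
Proof.
right; split=> [x||x xo]; [exact: root_perm_b|exact: section_b0|].
by rewrite section_b (_ : (x == 0%N :> nat) = (x == vertex0)) // (negPf xo);
  exists (x == i.+1 :> nat).
Qed.

Lemma famG_nucleus r g : generated (@fam_gens p r) g -> exists n,
    nucleus_at n g.
Proof.
suff /[apply] : generated (@fam_gens p r) `<=` [set g | exists n,
  nucleus_at n g] by [].
apply: generatedS => [|f].
  apply/is_subgroupP; split=> [|g1 g2 [n1 N1] [n2 N2]|g1 [n1 N1]].
  - by exists 0%N; left; exists 0%N.
  - exists (maxn n1 n2).+1; apply: nucleus_atM.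
      by apply: nucleus_at_leq N1; exact: leq_maxl.
    by apply: nucleus_at_leq N2; exact: leq_maxr.
  - by exists n1; exact: nucleus_atV.
by case=> [->|[i _ <-]]; exists 0%N; [exact: (a_nucleus 1)|exact: b_nucleus].
Qed.

Section Exponent.
Variable y : 'I_p.
Hypothesis yo : y != vertex0.

(** For a product of the [b_i] and [y] the vertex [i + 1], this is the exponent of [b_i]. *)
Definition exponent g : 'F_p := label (sec g y).

Lemma exponent_rooted g : rooted_part g -> exponent g = 0.
Proof. by move=> gr; rewrite /exponent rooted_part_section // label1. Qed.

(** A directed element recurs at vertex 0 and has rooted sections elsewhere; rooted elements have
    exponent 0. *)
Lemma sum_exponent_section g : nucleus g ->
    \sum_x exponent (sec g x) = exponent g.
Proof.
move=> [gr|[gt go gx]].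
  rewrite [RHS]exponent_rooted // big1 // => x _.
  by apply: exponent_rooted; exists 0%N; rewrite rooted_part_section.
by rewrite (bigD1 vertex0) //= go big1 ?addr0 // => x xo;
  apply/exponent_rooted/gx.
Qed.

(** The product may leave the nucleus, so additivity is stated one level down. A rooted factor at
    most permutes the sections of the other; two directed factors add their exponents at [y]. *)
Lemma sum_exponentM_section g h : nucleus g -> nucleus h ->
  \sum_x exponent (sec (g * h)%g x) = exponent g + exponent h.
Proof.
move=> ng nh; case: (ng) => [gr|gd].
  rewrite exponent_rooted // add0r -sum_exponent_section //.
  rewrite [RHS](reindex_inj (can_inj (@root_permK p g))) /=.
  by apply: eq_bigr => x _; rewrite sectionM rooted_part_section // mul1g.
case: (nh) => [hr|hd].
  rewrite [exponent h]exponent_rooted // addr0 -sum_exponent_section //.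
  by apply: eq_bigr => x _; rewrite sectionM [sec h _]rooted_part_section //
    mulg1.
rewrite sum_exponent_section; last by right; exact: directed_partM.
have [[gt _ gx] [ht _ hx]] := (gd, hd).
have [[s gs] [s' hs]] := (gx y yo, hx y yo).
by rewrite /exponent sectionM gt gs hs -expgnDr !label_aX natrD.
Qed.

Fixpoint exponent_at n g : 'F_p :=
  if n is m.+1 then \sum_x exponent_at m (sec g x) else exponent g.

Lemma exponent_atS n g : nucleus_at n g -> exponent_at n.+1 g = exponent_at n g.
Proof.
elim: n g => [|n IHn] g gn; first exact: sum_exponent_section.
by apply: eq_bigr => x _; apply: IHn; exact: gn.
Qed.

Lemma exponent_at_leq m n g : (m <= n)%N -> nucleus_at m g ->
  exponent_at n g = exponent_at m g.
Proof.
move=> /subnK <-; elim: (n - m)%N => [|d IHd] // gm.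
rewrite addSn exponent_atS ?IHd //; apply: nucleus_at_leq gm.
exact: leq_addl.
Qed.

Lemma exponent_atM n g h : nucleus_at n g -> nucleus_at n h ->
  exponent_at n.+1 (g * h)%g = exponent_at n g + exponent_at n h.
Proof.
elim: n g h => [|n IHn] g h gn hn; first exact: sum_exponentM_section.
rewrite [RHS]/= [X in _ + X](reindex_inj (can_inj (@root_permK p g)))
  -big_split.
by apply: eq_bigr => x _; rewrite sectionM; apply: IHn; [exact: gn|exact: hn].
Qed.

Lemma exponent_hom r : exists chi : T -> 'F_p,
  (forall g h, generated (@fam_gens p r) g -> generated (@fam_gens p r) h ->
     chi (g * h)%g = chi g + chi h) /\
  forall g, nucleus g -> chi g = exponent g.
Proof.
have nP g : exists n, (exists m, nucleus_at m g) -> nucleus_at n g.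
  by have [[m gm]|no] := pselect (exists m, nucleus_at m g);
    [exists m|exists 0%N].
have [N NP] := choice nP.
have chiE n g : nucleus_at n g -> exponent_at (N g) g = exponent_at n g.
  move=> gn; have gN : nucleus_at (N g) g by apply: NP; exists n.
  by case/orP: (leq_total n (N g)) => le; [|symmetry]; apply: exponent_at_leq.
exists (fun g => exponent_at (N g) g); split=> [g h|g gn].
  move=> /famG_nucleus[n1 g1] /famG_nucleus[n2 h2].
  have gm : nucleus_at (maxn n1 n2) g by apply: nucleus_at_leq g1;
    exact: leq_maxl.
  have hm : nucleus_at (maxn n1 n2) h by apply: nucleus_at_leq h2;
    exact: leq_maxr.
  by rewrite (chiE _ _ (nucleus_atM gm hm)) (chiE _ _ gm) (chiE _ _ hm)
    exponent_atM.
exact: (@chiE 0%N).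
Qed.
End Exponent.

(** Coordinate 0 is [label]; coordinate [k > 0] is the exponent read at vertex [k], which exists
    because [k <= r < p]. *)
Lemma famG_abelianisation r : (r < p)%N -> exists chi : T -> 'rV['F_p]_r.+1,
  [/\ forall g h, generated (@fam_gens p r) g -> generated (@fam_gens p r) h ->
        chi (g * h)%g = chi g + chi h,
      chi a = delta_mx 0 ord0 &
      forall i : 'I_r, chi (directed_b p i) = delta_mx 0 (lift ord0 i)].
Proof.
move=> r_lt.
have chiP (k : 'I_r.+1) : exists chi : T -> 'F_p, 
    [/\ forall g h, generated (@fam_gens p r) g ->
      generated (@fam_gens p r) h ->
          chi (g * h)%g = chi g + chi h,
        chi a = (k == ord0)%:R &
        forall i, chi (directed_b p i) = (k == i.+1 :> nat)%:R].
  have [->|k0] := eqVneq k ord0.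
    exists label; split=> [g h|| i]; first exact: labelM.
      exact: (label_aX 1).
    by apply: (@labelE _ 0) => x; rewrite root_perm_b.
  have kp : (k < p)%N by exact: leq_trans (ltn_ord k) r_lt.
  have yo : Ordinal kp != vertex0 by exact: k0.
  have [chi [chiM chiE]] := exponent_hom yo r.
  exists chi; split=> [//||i].
    by rewrite chiE ?exponent_rooted //; [exists 1%N|exact: (a_nucleus 1)].
  rewrite chiE; last exact: b_nucleus.
  by rewrite /exponent section_b (_ : (_ == 0%N) = false) ?label_aX //;
    exact/negbTE.
have [chi {}chiP] := choice chiP.
exists (fun g => \row_k chi k g); split=> [g h Gg Gh||i]; apply/rowP => k;
  rewrite !mxE.
- by have [chiM _ _] := chiP k; exact: chiM.
- by have [_ chia _] := chiP k; rewrite chia eq_sym.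
- by have [_ _ chib] := chiP k; rewrite chib.
Qed.
End Homomorphisms.

(** * The groups as multi-EGS groups *)

Section MultiEGS.
Variable p : nat.
Hypothesis p_pr : prime p.

(** For the last index [j] the [drop] is empty, so the directed element stands at vertex 0; row [i]
    of [pid_mx m] is a unit vector. *)
Lemma egs_sections_unit (j : 'I_p) m (i : 'I_m) : (m <= p.-1)%N ->
    j = p.-1 :> nat ->
  directed (egs_sections j (row i (pid_mx m : 'M['F_p]_(m,
    p.-1)))) = directed_b p i.
Proof.
move=> mp jp; rewrite /egs_sections /directed_b.
set c := [seq _ | k <- enum 'I_p.-1].
have sc : size c = p.-1 by rewrite size_map size_enum_ord.
rewrite drop_oversize ?sc ?jp // take_oversize ?sc // cat0s;
  congr (directed (_ :: _)).
rewrite /c -val_enum_ord -[RHS]map_comp; apply: eq_map => k /=;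
  congr (Some (_ ^+ _)).
by rewrite !mxE ltn_ord andbT eq_sym; case: eqP.
Qed.

Lemma famG_multi_EGS r : (0 < r)%N -> (r < p)%N -> multi_EGS (famG p r).
Proof.
move=> r_gt0 r_lt; have p_pos := prime_gt0 p_pr.
have jp : (p.-1 < p)%N by rewrite ltn_predL.
pose j0 := Ordinal jp.
pose rk j := if j == j0 then Ordinal r_lt else Ordinal p_pos.
have rk_le j : (rk j <= p.-1)%N by rewrite -ltnS prednK.
exists rk, (fun j => pid_mx (rk j)); split.
- by exists j0; rewrite /rk eqxx.
- by move=> j; rewrite /row_free rank_pid_mx.
congr (generated (_ `|` _)); apply/seteqP; split=> [_ [i ir <-]|_ [j [i ->]]].
  have ir0 : (i < rk j0)%N by rewrite /rk eqxx.
  by exists j0, (Ordinal ir0); rewrite egs_sections_unit.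
have [jE|jN] := eqVneq j j0; last first.
  by have := ltn_ord i; rewrite {2}/rk (negPf jN).
exists (i : nat); last by rewrite egs_sections_unit // jE.
have rkE : rk j = r :> nat by rewrite /rk jE eqxx.
exact: leq_trans (ltn_ord i) (eq_leq rkE).
Qed.
End MultiEGS.

(** * Completions distinguished by the number of generators *)

Section NonIsomorphic.
Variables (p r s : nat).
Hypotheses (p_pr : prime p) (rs : (r < s)%N) (s_lt : (s < p)%N).
Local Notation T := (tree_aut p).
Local Notation a := (@rooted_a p).
Local Notation HT := (subgroup_type (famG p s)).
Local Notation GT := (subgroup_type (famG p r)).
Local Open Scope ring_scope.

(** The kernel of [chi] has finite index, so [chi] extends to the completion by evaluating it on any
    representative of the coset at [N]. *)
Lemma completion_quotient (n : nat) (chi : T -> 'rV['F_p]_n) :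
    (forall g h, generated (@fam_gens p s) g -> generated (@fam_gens p s) h ->
      chi (g * h)%g = chi g + chi h) ->
  exists (N : finite_index_normal HT) (X : profinite_completion HT ->
    'rV['F_p]_n),
    [/\ forall x y, pc_fun x N = pc_fun y N -> X x = X y,
        forall x y, X (x * y)%g = X x + X y &
        forall h : HT, X (pc_iota h) = chi (val h)].
Proof.
move=> chiM; pose f (x : HT) := chi (val x).
have fM x y : f (x * y)%g = f x + f y.
  by rewrite /f valM; apply: chiM; exact: (@subgroup_valP _ (famG p s)).
have f1 : f 1%g = 0 by apply: (addrI (f 1%g)); rewrite -fM mulg1 addr0.
have fV x : f x^-1%g = - f x by apply: (addrI (f x));
  rewrite -fM mulgV f1 subrr.
have sN : is_subgroup [set x | f x = 0].
  apply/is_subgroupP; split=> [|x y /= fx fy|x /= fx] //.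
  - by rewrite fM fx fy addr0.
  - by rewrite fV fx oppr0.
have nN : normalised [set x | f x = 0].
  by move=> x y /= fx; rewrite !fM fV fx add0r addNr.
have finN : finite_set (lcosets setT [set x | f x = 0]).
  by apply: (finite_lcosets (f := f) sN) => x y xy /=; rewrite fM fV xy addNr.
pose N := FiniteIndexNormal sN nN finN.
have [h hE] := choice (fun x : profinite_completion HT => pcE x N).
have XE x g : pc_fun x N g -> f (h x) = f g.
  rewrite hE => /mem_lcoset /=; rewrite fM fV => /eqP.
  by rewrite addrC subr_eq0 => /eqP.
have hx x : pc_fun x N (h x) by apply/pc_memE.
exists N, (fun x => f (h x)); split=> [x y xy|x y|g].
- by apply: XE; rewrite xy; exact: hx.
- by rewrite -fM; apply: XE => /=; exists (h x) => //; exists (h y).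
- by apply: XE; apply/pc_memE.
Qed.

(** An isomorphism would give a map from [G_r] to ['F_p ^ (s + 1)] with values spanned by
    [r + 1 < s + 1] vectors, so some nonzero [l] annihilates them. By density it annihilates all
    values of [X], among them the standard basis. *)
Theorem famG_completion_not_isomorphic :
  ~ topologically_isomorphic (profinite_completion GT) (profinite_completion
    HT).
Proof.
move=> [f [f' [fK f'K f_cont _]]].
have [chi [chiM chia chib]] := famG_abelianisation p_pr s_lt.
have [N [X [XN XM Xchi]]] := completion_quotient chiM.
pose th (x : GT) := X (f (pc_iota x)).
have thM x y : th (x * y)%g = th x + th y by rewrite /th pc_iotaM gmulfM XM.
have th1 : th 1%g = 0 by apply: (addrI (th 1%g)); rewrite -thM mulg1 addr0.
have thV x : th x^-1%g = - th x by apply: (addrI (th x));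
  rewrite -thM mulgV th1 subrr.
have [a' a'E] := @subgroup_lift _ (famG p r) _ (@a_mem p r).
have b'P (i : 'I_r) : exists b' : GT, val b' = directed_b p i.
  by apply: (@subgroup_lift _ (famG p r)); exact: b_mem.
have [b' b'E] := choice b'P.
pose A : 'M['F_p]_(1 + r, s.+1) := col_mx (th a') (\matrix_i th (b' i)).
have [l l_neq0 lA] : exists2 l : 'rV['F_p]_s.+1, l != 0 & l *m A^T = 0.
  have /rowV0Pn[l ll l0] : kermx A^T != 0.
    rewrite -mxrank_eq0 mxrank_ker -lt0n subn_gt0.
    by apply: leq_ltn_trans (rank_leq_col _) _; rewrite add1n ltnS.
  by exists l => //; exact/sub_kermxP.
have thl x : th x *m l^T = 0.
  have sP : is_subgroup [set g : T | exists2 y : GT,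
    val y = g & th y *m l^T = 0].
    apply/is_subgroupP; split=> [|_ _ [y1 <- l1] [y2 <- l2]|_ [y1 <- l1]].
    - by exists 1%g; rewrite ?val1 // th1 mul0mx.
    - by exists (y1 * y2)%g; rewrite ?valM // thM mulmxDl l1 l2 addr0.
    - by exists y1^-1%g; rewrite ?gmulfV // thV mulNmx l1 oppr0.
  have Al : A *m l^T = 0 by apply: trmx_inj; rewrite trmx_mul trmxK lA trmx0.
  rewrite /A mul_col_mx in Al.
  have la : th a' *m l^T = 0 by have := congr1 usubmx Al;
    rewrite col_mxKu linear0.
  have lb i : th (b' i) *m l^T = 0.
    have := congr1 (row i \o dsubmx) Al.
    by rewrite /= col_mxKd row_mul rowK !linear0.
  have := generatedS sP _ (subgroup_valP x); case=>
    [_ [->|[i ir <-]]|y /val_inj -> //].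
    by exists a'.
  by exists (b' (Ordinal ir)).
have Xl (z : profinite_completion HT) : X z *m l^T = 0.
  (* Surjectivity of [f] reduces to [f x]; by continuity some [g] in [G_r] gives the same coset at
     [N]. *)
  rewrite -(f'K z); move: (f' z) => x.
  have /pc_nbhsE[M MN] : nbhs x (f @^-1` [set w | pc_fun w N = pc_fun (f x) N]).
    by apply: f_cont; exact: pc_nbhs.
  have [g xg] := pcE x M.
  by rewrite -(thl g); congr (_ *m _); apply: XN; apply/esym/MN.
have {}Xl g : generated (@fam_gens p s) g -> chi g *m l^T = 0.
  by move=> /(@subgroup_lift _ (famG p s))[x <-]; rewrite -Xchi Xl.
case/eqP: l_neq0; apply/rowP => k; rewrite mxE.
have unit_l (j : 'I_s.+1) : (delta_mx 0 j : 'rV['F_p]_s.+1) *m l^T = 0 ->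
  l 0 j = 0.
  by move=> /(congr1 (fun M : 'M['F_p]_1 => M 0 0)); rewrite -rowE !mxE.
apply: unit_l; case: (unliftP ord0 k) => [i|] ->.
  by rewrite -chib; apply: Xl; exact: b_mem.
by rewrite -chia; apply: Xl; exact: a_mem.
Qed.
End NonIsomorphic.

Theorem corollary1p7 (R : realType) (p : nat) (p_prime : prime p)
    (p_ge3 : (3 <= p)%N) :
  exists G H : subgroup (tree_aut p),
    [/\ multi_EGS G /\ multi_EGS H,
        ~ torsion (subgroup_type G) /\ ~ torsion (subgroup_type H),
        ~ topologically_isomorphic
            (profinite_completion (subgroup_type G))
            (profinite_completion (subgroup_type H)),
        finite_central_width (profinite_completion (subgroup_type G)) R p &
        finite_central_width (profinite_completion (subgroup_type H)) R p].
Proof.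
have p_gt1 := prime_gt1 p_prime.
(* Both ranks are below [p] as [p >= 3]; the group of larger rank is the second one. *)
exists (famG p 1), (famG p 2); split.
- by split; exact: famG_multi_EGS.
- by split; exact: famG_not_torsion.
- exact: famG_completion_not_isomorphic.
- exact: famG_finite_central_width.
- exact: famG_finite_central_width.
Qed.
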